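(* Let $(N^3,g)$ be a three-dimensional Riemannian manifold with a unit vector field $\xi$ that is parallel with respect to the Levi-Civita connection $\nabla$, and let $\widehat{\nabla}$ be the semi-symmetric non-metric connection on $N^3$ with associated vector field $\xi$, i.e. $\widehat{\nabla}_UV=\nabla_UV+g(V,\xi)U$. If $g$ is a gradient Einstein soliton with respect to $\widehat{\nabla}$, then $N^3$ is either a manifold of constant scalar curvature (i.e. $\widehat{r}$ is constant) or a manifold of constant sectional curvature with respect to $\widehat{\nabla}$.
   Context: $\nabla$ is the Levi-Civita connection of $g$ and $\psi$ is the $1$-form $\psi(U)=g(U,\xi)$. It is a standing assumption that $\xi$ is a unit vector field with $\nabla_U\xi=0$ for all $U$. The curvature of $\widehat{\nabla}$ is $\widehat{R}(U,V)Y=\widehat{\nabla}_U\widehat{\nabla}_VY-\widehat{\nabla}_V\widehat{\nabla}_UY-\widehat{\nabla}_{[U,V]}Y$, its Ricci tensor is $\widehat{\mathcal{S}}(V,Y)=\mathrm{trace}(U\mapsto\widehat{R}(U,V)Y)$, and its scalar curvature $\widehat{r}$ is the $g$-trace of $\widehat{\mathcal{S}}$. $Df$ is the gradient of $f$ with respect to $g$, and $\widehat{\nabla}^2f(U,V)=g(\widehat{\nabla}_UDf,V)$. The metric $g$ is a gradient Einstein soliton (with respect to $\widehat{\nabla}$) if there are a smooth function $f$ and a real constant $\lambda$ with $\widehat{\mathcal{S}}-\frac{1}{2}\widehat{r}g+\widehat{\nabla}^2f+\lambda g=0$. ''Constant sectional curvature with respect to $\widehat{\nabla}$'' means that there is a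 constant $c$ with $\widehat{R}(U,V)Y=c\,[g(V,Y)U-g(U,Y)V]$ for all vector fields $U,V,Y$.
   Formalization: The manifold N is assumed connected (the usual convention); without this the claim fails, e.g. for the disjoint union of flat R^3 and R×S^2 of Gauss curvature 2, where the scalar curvature takes the values 2 and 6. *)

(* Defs.v *)
From HB Require Import structures.
From mathcomp Require Import all_boot all_order all_algebra.
From mathcomp Require Import all_classical all_reals all_analysis.

Set Implicit Arguments.
Unset Strict Implicit.
Unset Printing Implicit Defensive.

Import Order.TTheory GRing.Theory Num.Theory.
Import numFieldNormedType.Exports.

Local Open Scope classical_set_scope.
Local Open Scope ring_scope.

(* C^k and C^oo maps on an open set A; nothing is required outside A. *)
Fixpoint Ck (R : realType) (V W : normedModType R) (k : nat) (A : set V)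
    (f : V -> W) : Prop :=
  match k with
  | 0 => forall x, A x -> {for x, continuous f}
  | k'.+1 => (forall x, A x -> differentiable f x) /\
             (forall v : V, Ck k' A (fun x => 'D_v f x))
  end.

Definition smooth_on (R : realType) (V W : normedModType R) (A : set V)
    (f : V -> W) : Prop := forall k : nat, Ck k A f.

(* A chart is a homeomorphism from an open set of T onto an open set of R^n;
   only the restrictions of cmap to cdom and of cinv to cmap @` cdom matter. *)
Record chart (R : realType) (n : nat) (T : topologicalType) := Chart {
  cdom : set T;
  cmap : T -> 'rV[R]_n;
  cinv : 'rV[R]_n -> T;
  cdom_open : open cdom;
  cimg_open : open (cmap @` cdom);
  cmapK : forall p, cdom p -> cinv (cmap p) = p;
  cmap_continuous : {within cdom, continuous cmap};
  cinv_continuous : {within cmap @` cdom, continuous cinv}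
}.

Definition cimg (R : realType) (n : nat) (T : topologicalType)
  (c : chart R n T) : set 'rV[R]_n := cmap c @` cdom c.

(* Smooth n-manifolds (Hausdorff, second countable, without boundary).  The
   smooth structure is given by an atlas which is indexed by the points: every
   atlas contains such a family, and the family determines the structure. *)
Record smooth_manifold (R : realType) (n : nat) := SmoothManifold {
  mspace :> topologicalType;
  mspace_hausdorff : hausdorff_space mspace;
  mspace_second_countable : @second_countable mspace;
  chart_at : mspace -> chart R n mspace;
  chart_at_dom : forall p, cdom (chart_at p) p;
  chart_at_compat : forall p q,
    smooth_on (cmap (chart_at p) @` (cdom (chart_at p) `&` cdom (chart_at q)))
              (cmap (chart_at q) \o cinv (chart_at p))
}.

Section Manifold.
Context (R : realType) (n : nat) (M : smooth_manifold R n).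

Definition coord (p : M) : M -> 'rV[R]_n := cmap (chart_at p).
Definition param (p : M) : 'rV[R]_n -> M := cinv (chart_at p).

Definition smooth_fun (f : M -> R) : Prop :=
  forall q : M, smooth_on (cimg (chart_at q)) (f \o param q).

(* The tangent space at p is identified with R^n through the chart chart_at p:
   X p is the row of components of the vector X_p in that chart. *)
Definition vfield := M -> 'rV[R]_n.

(* Components of X in the fixed chart chart_at q, as a function of the
   coordinates: X_y is transported by the differential of the transition map
   from chart_at y to chart_at q. *)
Definition vf_rep (X : vfield) (q : M) : 'rV[R]_n -> 'rV[R]_n :=
  fun x => let y := param q x in 'D_(X y) (coord q \o param y) (coord y y).

Definition smooth_vf (X : vfield) : Prop :=
  forall q : M, smooth_on (cimg (chart_at q)) (vf_rep X q).

Definition vf_app (X : vfield) (f : M -> R) : M -> R :=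
  fun p => 'D_(X p) (f \o param p) (coord p p).

Definition vf_add (X Y : vfield) : vfield := fun p => X p + Y p.
Definition vf_sub (X Y : vfield) : vfield := fun p => X p - Y p.
Definition vf_scale (f : M -> R) (X : vfield) : vfield := fun p => f p *: X p.

(* [X, Y]^i = X^j d_j Y^i - Y^j d_j X^i, computed at p in chart_at p. *)
Definition lie_bracket (X Y : vfield) : vfield := fun p =>
  'D_(X p) (vf_rep Y p) (coord p p) - 'D_(Y p) (vf_rep X p) (coord p p).

Definition inner (g : M -> 'M[R]_n) (X Y : vfield) : M -> R :=
  fun p => (X p *m g p *m (Y p)^T) ord0 ord0.

Record riemannian_metric := RiemannianMetric {
  metric_mx :> M -> 'M[R]_n;
  metric_sym : forall p, (metric_mx p)^T = metric_mx p;
  metric_pos : forall p (v : 'rV[R]_n), v != 0 ->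
    0 < (v *m metric_mx p *m v^T) ord0 ord0;
  metric_smooth : forall X Y : vfield, smooth_vf X -> smooth_vf Y ->
    smooth_fun (inner metric_mx X Y)
}.

(* Only the values on smooth vector fields are meaningful. *)
Record is_connection (D : vfield -> vfield -> vfield) : Prop := IsConnection {
  conn_smooth : forall U V, smooth_vf U -> smooth_vf V -> smooth_vf (D U V);
  conn_addl : forall U V W, smooth_vf U -> smooth_vf V -> smooth_vf W ->
    D (vf_add U V) W = vf_add (D U W) (D V W);
  conn_scalel : forall f U V, smooth_fun f -> smooth_vf U -> smooth_vf V ->
    D (vf_scale f U) V = vf_scale f (D U V);
  conn_addr : forall U V W, smooth_vf U -> smooth_vf V -> smooth_vf W ->
    D U (vf_add V W) = vf_add (D U V) (D U W);
  conn_leibniz : forall f U V, smooth_fun f -> smooth_vf U -> smooth_vf V ->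
    D U (vf_scale f V) = vf_add (vf_scale (vf_app U f) V) (vf_scale f (D U V))
}.

Record is_levi_civita (g : riemannian_metric)
    (D : vfield -> vfield -> vfield) : Prop := IsLeviCivita {
  lc_connection : is_connection D;
  lc_torsion_free : forall U V, smooth_vf U -> smooth_vf V ->
    vf_sub (D U V) (D V U) = lie_bracket U V;
  lc_metric : forall U V W, smooth_vf U -> smooth_vf V -> smooth_vf W ->
    forall p, vf_app U (inner g V W) p =
              inner g (D U V) W p + inner g V (D U W) p
}.

Definition semi_symmetric_conn (g : riemannian_metric)
    (nabla : vfield -> vfield -> vfield) (xi : vfield) :
    vfield -> vfield -> vfield :=
  fun U V => vf_add (nabla U V) (vf_scale (inner g V xi) U).

Definition curvature (D : vfield -> vfield -> vfield) (U V Y : vfield) :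
    vfield :=
  vf_sub (vf_sub (D U (D V Y)) (D V (D U Y))) (D (lie_bracket U V) Y).

(* Matrix at p (acting on row vectors) of the endomorphism of the tangent
   space induced by a tensorial map T on smooth vector fields. *)
Definition endo_mx (T : vfield -> vfield) (p : M) : 'M[R]_n :=
  xget 0 [set A | forall U, smooth_vf U -> T U p = U p *m A].

(* Matrix at p of the bilinear form induced by a tensorial map B. *)
Definition form_mx (B : vfield -> vfield -> M -> R) (p : M) : 'M[R]_n :=
  xget 0 [set A | forall U V, smooth_vf U -> smooth_vf V ->
                    B U V p = (U p *m A *m (V p)^T) ord0 ord0].

Definition ricci (D : vfield -> vfield -> vfield) (V Y : vfield) : M -> R :=
  fun p => \tr (endo_mx (fun U => curvature D U V Y) p).

(* g-trace g^{ij} B_{ij} of a bilinear form. *)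
Definition metric_trace (g : riemannian_metric)
    (B : vfield -> vfield -> M -> R) : M -> R :=
  fun p => \tr (invmx (g p) *m form_mx B p).

Definition scalar_curvature (g : riemannian_metric)
    (D : vfield -> vfield -> vfield) : M -> R :=
  metric_trace g (ricci D).

(* (grad f)^i = d_j f g^{ji} in chart_at p, i.e. g(grad f, V) = V f. *)
Definition gradient (g : riemannian_metric) (f : M -> R) : vfield := fun p =>
  (\row_j 'D_(delta_mx ord0 j) (f \o param p) (coord p p)) *m invmx (g p).

Definition hessian (g : riemannian_metric) (D : vfield -> vfield -> vfield)
    (f : M -> R) (U V : vfield) : M -> R :=
  inner g (D U (gradient g f)) V.

Definition gradient_einstein_soliton (g : riemannian_metric)
    (D : vfield -> vfield -> vfield) : Prop :=
  exists (f : M -> R) (lambda : R), smooth_fun f /\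
    forall U V, smooth_vf U -> smooth_vf V -> forall p,
      ricci D U V p - 2^-1 * scalar_curvature g D p * inner g U V p
      + hessian g D f U V p + lambda * inner g U V p = 0.

Definition constant_scalar_curvature (g : riemannian_metric)
    (D : vfield -> vfield -> vfield) : Prop :=
  exists c : R, forall p, scalar_curvature g D p = c.

Definition constant_sectional_curvature (g : riemannian_metric)
    (D : vfield -> vfield -> vfield) : Prop :=
  exists c : R, forall U V Y, smooth_vf U -> smooth_vf V -> smooth_vf Y ->
    forall p, curvature D U V Y p =
              c *: (inner g V Y p *: U p - inner g U Y p *: V p).

End Manifold.

(* Main.v *)
(** Write [phi = g(grad f, xi)], let [K] be the curvature of the plane orthogonal to [xi],
    and let [R] be the Levi-Civita curvature.  Since [xi] is parallel, [R(U,V)] is skew and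
    kills [xi], and the curvature of the semi-symmetric connection is
    [R(U,V)Y + psi(Y)(psi(V)U - psi(U)V)].  The soliton equation makes the Ricci tensor
    symmetric (the Hessian of [f] is), and in dimension 3 this already forces
    [R(xi,V)V = 0] for [V] orthogonal to [xi]; no Bianchi identity is needed.  The soliton
    equation becomes [nabla_U grad f = b U + (H - b) psi(U) xi] with
    [b = 1 - lambda - phi], [H = xi(phi)], and the scalar curvature is
    [2(K + 1) = 2(2 + lambda + phi + H)].  Differentiating once more,
    [g(R(xi,V) grad f, V) = xi(b) = -H] for unit [V] orthogonal to [xi], while the left-hand
    side is [-g(R(xi,V)V, grad f) = 0].  Hence [H = 0], so [d phi = H psi = 0], [phi] is
    constant by connectedness, and so is the scalar curvature.  (The second alternative of
    the theorem never holds on a nonempty manifold.)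

    The traces are only meaningful because vector fields extend from a point to the whole
    manifold and function-linear maps are pointwise; this is where bump functions enter. *)

Require Import Defs.
From HB Require Import structures.
From mathcomp Require Import all_boot all_order all_algebra.
From mathcomp Require Import all_classical all_reals all_analysis.
From mathcomp Require Import ring lra.
Import Order.TTheory GRing.Theory Num.Theory.
Import numFieldNormedType.Exports.
(* Again, because [coord] is also a name of mathcomp's [vector]. *)
Import Defs.

Set Implicit Arguments.
Unset Strict Implicit.
Unset Printing Implicit Defensive.

Local Open Scope classical_set_scope.
Local Open Scope ring_scope.

(** * Calculus of C^k maps *)

(** The first-order expansion of [f] at [x] is also one of [g], since its remainder only sees values
    near [x]; uniqueness of the differential concludes. *)
Lemma near_eq_differentiable (R : realType) (V W : normedModType R)
    (f g : V -> W) (x : V) :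
  (\forall y \near x, f y = g y) -> differentiable f x -> differentiable g x.
Proof.
move=> fg df.
have fgx : f x = g x by exact: nbhs_singleton fg.
have e : g \o shift x = cst (g x) + 'd f x +o_ (0 : V) id.
  apply/eqaddoP => eps e0.
  have /eqaddoP/(_ eps e0) H := diff_locally df.
  have fg0 : \forall h \near (0 : V), f (h + x) = g (h + x).
    move: fg; rewrite (near_shift 0) subr0; exact: filterS.
  apply: filterS2 H fg0 => h.
  by rewrite /= !fctE /= -fgx => + <-.
have dg := diff_unique (diff_continuous df) e.
by apply/diff_locallyP; rewrite dg; split => //; exact: diff_continuous.
Qed.

Section Calculus.
Context (R : realType).
Implicit Types V W : normedModType R.

Lemma open_near (T : topologicalType) (A : set T) (P : T -> Prop) x : open A -> A x ->
  (forall y, A y -> P y) -> \forall y \near x, P y.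
Proof.
by move=> oA Ax AP; apply: filterS AP _; exact: open_nbhs_nbhs.
Qed.

Lemma CkS V W k (A : set V) (f : V -> W) : Ck k.+1 A f -> Ck k A f.
Proof.
elim: k f => [f [df _] x Ax|k IH f [df Df]].
  by apply: differentiable_continuous; exact: df.
split=> // v; exact/IH/Df.
Qed.

Lemma Ck_sub V W k (A B : set V) (f : V -> W) :
  B `<=` A -> Ck k A f -> Ck k B f.
Proof.
move=> BA; elim: k f => [f cf x Bx|k IH f [df Df]]; first by apply: cf; exact: BA.
by split=> [x Bx|v]; [exact/df/BA|exact/IH/Df].
Qed.

Lemma Ck_ext V W k (A : set V) (f g : V -> W) : open A ->
  (forall x, A x -> f x = g x) -> Ck k A f -> Ck k A g.
Proof.
move=> oA; elim: k f g => [f g fg cf x Ax|k IH f g fg [df Df]].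
  have fgx := open_near oA Ax fg.
  rewrite /prop_for /continuous_at -fg//.
  have := cf _ Ax; rewrite /prop_for /continuous_at; apply: cvg_trans.
  by apply: near_eq_cvg; apply: filterS fgx => y ->.
split=> [x Ax|v].
  by apply: near_eq_differentiable (df _ Ax); exact: open_near fg.
apply: IH (Df v) => x Ax; apply: near_eq_derive.
exact: open_near fg.
Qed.

(** Every clause of [Ck] concerns one point of [A], with derivatives taken in the ambient space, so
    it can be checked one point at a time. *)
Lemma Ck_local V W k (A : set V) (f : V -> W) :
  (forall x, A x -> exists B, B x /\ Ck k B f) -> Ck k A f.
Proof.
elim: k f => [f H x Ax|k IH f H]; first by have [B [Bx]] := H x Ax; exact.
split=> [x Ax|v]; first by have [B [Bx [+ _]]] := H x Ax; exact.
by apply: IH => x Ax; have [B [Bx [_ /(_ v)]]] := H x Ax; exists B.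
Qed.

Lemma smooth_on_sub V W (A B : set V) (f : V -> W) :
  B `<=` A -> smooth_on A f -> smooth_on B f.
Proof. by move=> BA sf k; exact: Ck_sub (sf k). Qed.

Lemma smooth_on_local V W (A : set V) (f : V -> W) :
  (forall x, A x -> exists B, B x /\ smooth_on B f) -> smooth_on A f.
Proof.
move=> H k; apply: Ck_local => x Ax; have [B [Bx sf]] := H x Ax.
by exists B.
Qed.

Lemma smooth_on_differentiable V W (A : set V) (f : V -> W) x :
  smooth_on A f -> A x -> differentiable f x.
Proof. by move=> /(_ 1%N) [df _] Ax; exact: df. Qed.

Lemma smooth_on_derive V W (A : set V) (f : V -> W) v :
  smooth_on A f -> smooth_on A ('D_v f).
Proof. by move=> sf k; have [_] := sf k.+1; exact. Qed.

Lemma Ck_cst V W k (A : set V) (c : W) : Ck k A (fun=> c).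
Proof.
elim: k c => [c x _|k IH c]; first exact: cst_continuous.
split=> [x _|v]; first exact: differentiable_cst.
by rewrite (_ : 'D_v _ = fun=> 0)//; apply/funext => x; exact: derive_cst.
Qed.

Lemma Ck_add V W k (A : set V) (f g : V -> W) : open A ->
  Ck k A f -> Ck k A g -> Ck k A (fun x => f x + g x).
Proof.
move=> oA; elim: k f g => [f g cf cg x Ax|k IH f g [df Df] [dg Dg]].
  by apply: continuousD; [exact: cf|exact: cg].
split=> [x Ax|v]; first by apply: differentiableD; [exact: df|exact: dg].
apply: (@Ck_ext _ _ _ _ (fun x => 'D_v f x + 'D_v g x)) => //; last exact: IH (Df v) (Dg v).
move=> x Ax; rewrite deriveD//; apply: diff_derivable; [exact: df|exact: dg].
Qed.

Lemma Ck_linear V W (W' : normedModType R) k (A : set V) (f : V -> W)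
    (L : {linear W -> W'}) : continuous L -> open A ->
  Ck k A f -> Ck k A (fun x => L (f x)).
Proof.
move=> cL oA; elim: k f => [f cf x Ax|k IH f [df Df]].
  apply: (@continuous_comp _ _ _ f L); [exact: cf|exact: cL].
have dL y : differentiable L y by exact: linear_differentiable.
split=> [x Ax|v]; first by apply: differentiable_comp => //; exact: df.
apply: Ck_ext (IH _ (Df v)) => // x Ax /=.
have dfx := df x Ax.
rewrite [RHS](_ : _ = 'd (L \o f) x v); last first.
  by rewrite -deriveE//; exact: differentiable_comp.
by rewrite diff_comp//= diff_lin//= deriveE.
Qed.


Lemma Ck_sum V W (I : Type) (r : seq I) (P : pred I) k (A : set V)
    (f : I -> V -> W) : open A -> (forall i, P i -> Ck k A (f i)) ->
  Ck k A (fun x => \sum_(i <- r | P i) f i x).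
Proof.
move=> oA H; elim: r => [|i r IH].
  by apply: Ck_ext (Ck_cst k A 0) => // x _; rewrite big_nil.
case Pi: (P i); last by apply: Ck_ext IH => // x _; rewrite big_cons Pi.
by apply: Ck_ext (Ck_add oA (H i Pi) IH) => // x _; rewrite big_cons Pi.
Qed.

Lemma Ck_mul V k (A : set V) (f g : V -> R) : open A ->
  Ck k A f -> Ck k A g -> Ck k A (fun x => f x * g x).
Proof.
move=> oA; elim: k f g => [f g cf cg x Ax|k IH f g Cf Cg].
  by apply: continuousM; [exact: cf|exact: cg].
have [df Df] := Cf; have [dg Dg] := Cg.
split=> [x Ax|v]; first by apply: differentiableM; [exact: df|exact: dg].
apply: (@Ck_ext _ _ _ _ (fun x => f x * 'D_v g x + g x * 'D_v f x)) => //.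
  move=> x Ax; rewrite deriveM//; apply: diff_derivable; [exact: df|exact: dg].
apply: Ck_add => //; first exact: IH (CkS Cf) (Dg v).
exact: IH (CkS Cg) (Df v).
Qed.

Lemma Ck_prod V (I : Type) (r : seq I) (P : pred I) k (A : set V)
    (f : I -> V -> R) : open A -> (forall i, P i -> Ck k A (f i)) ->
  Ck k A (fun x => \prod_(i <- r | P i) f i x).
Proof.
move=> oA H; elim: r => [|i r IH].
  by apply: Ck_ext (Ck_cst k A (1 : R)) => // x _; rewrite big_nil.
case Pi: (P i); last by apply: Ck_ext IH => // x _; rewrite big_cons Pi.
by apply: Ck_ext (Ck_mul oA (H i Pi) IH) => // x _; rewrite big_cons Pi.
Qed.

Lemma Ck_inv V k (A : set V) (f : V -> R) : open A ->
  (forall x, A x -> f x != 0) -> Ck k A f -> Ck k A (fun x => (f x)^-1).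
Proof.
move=> oA f0; elim: k f f0 => [f f0 cf x Ax|k IH f f0 Cf].
  by apply: continuousV; [exact: f0|exact: cf].
have [df Df] := Cf.
split=> [x Ax|v]; first by apply: differentiableV; [exact: df|exact: f0].
apply: (@Ck_ext _ _ _ _ (fun x => - 1 * ((f x)^-1 * (f x)^-1 * 'D_v f x))) => //.
  move=> x Ax; rewrite deriveV; last 2 first.
  - exact: f0.
  - exact/diff_derivable/df.
  by rewrite mulN1r scaleNr expr2 invfM.
have CV := IH _ f0 (CkS Cf).
apply: Ck_mul => //; first exact: Ck_cst.
by apply: Ck_mul => //; [exact: Ck_mul|exact: Df v].
Qed.

Lemma Ck_row V n k (A : set V) (f : V -> 'rV[R]_n) : open A ->
  (forall i, Ck k A (fun x => f x ord0 i)) -> Ck k A f.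
Proof.
move=> oA H.
apply: (@Ck_ext _ _ _ _ (fun x => \sum_(i < n) f x ord0 i *: delta_mx ord0 i)) => //.
  by move=> x _; rewrite -row_sum_delta.
apply: Ck_sum => // i _.
have lin : linear (fun t : R => t *: (delta_mx ord0 i : 'rV[R]_n)).
  by move=> a u w; rewrite scalerDl scalerA.
pose L : {linear R -> 'rV[R]_n} :=
  HB.pack (fun t : R => t *: (delta_mx ord0 i : 'rV[R]_n))
    (GRing.isLinear.Build _ _ _ _ _ lin).
by apply: (Ck_linear (L := L)) (H i) => //; exact: scalel_continuous.
Qed.

Lemma Ck_coord V n k (A : set V) (f : V -> 'rV[R]_n) i : open A ->
  Ck k A f -> Ck k A (fun x => f x ord0 i).
Proof.
move=> oA.
have lin : linear (fun u : 'rV[R]_n => u ord0 i) by move=> a u w; rewrite !mxE.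
pose L : {linear 'rV[R]_n -> R} :=
  HB.pack (fun u : 'rV[R]_n => u ord0 i) (GRing.isLinear.Build _ _ _ _ _ lin).
by apply: (Ck_linear (L := L)) => //; exact: coord_continuous.
Qed.

Lemma derive_dir n W (f : 'rV[R]_n -> W) x v : differentiable f x ->
  'D_v f x = \sum_(i < n) v ord0 i *: 'D_(delta_mx ord0 i) f x.
Proof.
move=> df; rewrite deriveE// {1}(row_sum_delta v) linear_sum.
by apply: eq_bigr => i _; rewrite linearZ deriveE.
Qed.

Lemma derive_chain (U : normedModType R) V W (f : U -> V) (g : V -> W) x v :
  differentiable f x -> differentiable g (f x) ->
  'D_v (g \o f) x = 'D_('D_v f x) g (f x).
Proof.
move=> df dg; rewrite !deriveE//; last exact: differentiable_comp.
by rewrite diff_comp.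
Qed.

Lemma derive_coord V n (f : V -> 'rV[R]_n) x v i : differentiable f x ->
  ('D_v f x) ord0 i = 'D_v (fun y => f y ord0 i) x.
Proof.
by move=> df; rewrite derive_mx ?mxE//; exact: diff_derivable.
Qed.

(** By the chain rule the derivative is a sum of products of a component of [D f] with a partial
    derivative of [g] composed with [f]; the latter is again a composition, one order lower. *)
Lemma Ck_compR V n k (A : set V) (B : set 'rV[R]_n) (f : V -> 'rV[R]_n)
    (g : 'rV[R]_n -> R) : open A -> open B -> (forall x, A x -> B (f x)) ->
  Ck k A f -> Ck k B g -> Ck k A (g \o f).
Proof.
move=> oA oB AB; elim: k g => [g cf cg x Ax|k IH g Cf Cg].
  by apply: continuous_comp; [exact: cf|exact/cg/AB].
have [df Df] := Cf; have [dg Dg] := Cg.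
split=> [x Ax|v]; first by apply: differentiable_comp; [exact: df|exact/dg/AB].
apply: (@Ck_ext _ _ _ _ (fun x => \sum_(i < n)
  ('D_v f x) ord0 i * ('D_(delta_mx ord0 i) g \o f) x)) => //.
  move=> x Ax; rewrite [RHS]derive_chain; last 2 first.
  - exact: df.
  - exact/dg/AB.
  by rewrite [RHS]derive_dir//; exact/dg/AB.
apply: Ck_sum => // i _; apply: Ck_mul => //; first exact: Ck_coord (Df v).
exact: IH (CkS Cf) (Dg _).
Qed.

Lemma Ck_comp V m n k (A : set V) (B : set 'rV[R]_n) (f : V -> 'rV[R]_n)
    (g : 'rV[R]_n -> 'rV[R]_m) : open A -> open B ->
    (forall x, A x -> B (f x)) ->
  Ck k A f -> Ck k B g -> Ck k A (g \o f).
Proof.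
move=> oA oB AB Cf Cg; apply: Ck_row => // i.
exact: (@Ck_compR _ _ _ _ B f (fun y => g y ord0 i)) (Ck_coord _ _ _).
Qed.

End Calculus.

(** * Mean value theorem and symmetry of second derivatives *)

Section MeanValue.
Context (R : realType) (V : normedModType R).
Implicit Types (f : V -> R) (u v x y : V).

Lemma derive_line f y u (t : R) : differentiable f (t *: u + y) ->
  is_derive t 1 (fun s => f (s *: u + y)) ('D_u f (t *: u + y)).
Proof.
move=> /diff_derivable -/(_ u) df.
have e : (fun h : R => h^-1 *: (((fun s => f (s *: u + y)) \o shift t) (h *: 1)
    - f (t *: u + y))) =
  (fun h : R => h^-1 *: ((f \o shift (t *: u + y)) (h *: u) - f (t *: u + y))).
  by apply/funext => h /=; rewrite [h%:A]mulr1 scalerDl addrA.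
apply: DeriveDef; first by rewrite /derivable e.
by rewrite /derive e.
Qed.

Lemma derive_translate f y u w :
  'D_u (fun z => f (z + w)) y = 'D_u f (y + w).
Proof.
have e : (fun h : R => h^-1 *: (((fun z => f (z + w)) \o shift y) (h *: u)
    - f (y + w))) =
  (fun h : R => h^-1 *: ((f \o shift (y + w)) (h *: u) - f (y + w))).
  by apply/funext => h /=; rewrite addrA.
by rewrite /derive e.
Qed.

Lemma mean_value_line f y u (h : R) : 0 < h ->
  (forall s, 0 <= s <= h -> differentiable f (s *: u + y)) ->
  exists2 s, 0 <= s <= h & f (h *: u + y) - f y = h * 'D_u f (s *: u + y).
Proof.
move=> h0 df.
have [s|s|s sh] := @MVT_segment R (fun s => f (s *: u + y))
  (fun s => 'D_u f (s *: u + y)) 0 h (ltW h0).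
- rewrite in_itv /= => /andP[s0 sh]; apply: derive_line.
  by apply: df; rewrite !ltW.
- apply: derivable_within_continuous => t; rewrite in_itv /= => th.
  by have [] := derive_line (df t th).
rewrite scale0r add0r subr0 mulrC => ->.
by exists s => //; move: sh; rewrite in_itv.
Qed.

(** The mean value theorem applies twice: along [u] to [F z = f (z + h v) - f z], then along [v] to
    [D_u f]. *)
Lemma second_difference f (A : set V) y u v (h : R) : 0 < h ->
  (forall s t, 0 <= s <= h -> 0 <= t <= h -> A (s *: u + (t *: v + y))) ->
  (forall z, A z -> differentiable f z) ->
  (forall z, A z -> differentiable ('D_u f) z) ->
  exists s t, [/\ 0 <= s <= h, 0 <= t <= h &
    f (h *: u + (h *: v + y)) - f (h *: v + y) - (f (h *: u + y) - f y) =
    h * (h * 'D_v ('D_u f) (s *: u + (t *: v + y)))].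
Proof.
move=> h0 hA df dDf.
have h00 : (0 : R) <= 0 <= h by rewrite lexx ltW.
have hh : 0 <= h <= h by rewrite lexx ltW.
pose F z := f (z + h *: v) - f z.
have dFz s : 0 <= s <= h -> differentiable (fun z => f (z + h *: v)) (s *: u + y).
  move=> sh; apply: differentiable_comp => //; apply: df.
  by rewrite -addrA [y + _]addrC; exact: hA.
have dfz s : 0 <= s <= h -> differentiable f (s *: u + y).
  by move=> sh; apply: df; have := hA s 0 sh h00; rewrite scale0r add0r.
have [s sh] := @mean_value_line F y u h h0
  (fun s sh => differentiableB (dFz s sh) (dfz s sh)).
rewrite /F deriveB; last 2 first.
- exact/diff_derivable/dFz.
- exact/diff_derivable/dfz.
rewrite derive_translate -!addrA ![y + _]addrC => Es.
have [|t th Et] := @mean_value_line ('D_u f) (s *: u + y) v h h0.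
  move=> t th; apply: dDf; rewrite addrCA; exact: hA sh th.
exists s, t; split => //.
rewrite [_ *: u + (t *: v + _)]addrCA -Et [h *: v + (_ + _)]addrCA.
by rewrite -Es; ring.
Qed.

(** The double difference over a parallelogram is symmetric in [u] and [v], so it equals [h^2] times
    each mixed derivative at some point of the parallelogram; continuity of both at [x] finishes. *)
Lemma schwarz f (A : set V) x u v : open A -> A x -> Ck 2 A f ->
  'D_u ('D_v f) x = 'D_v ('D_u f) x.
Proof.
move=> oA Ax [df Df].
have [dDu /(_ v) cDu] := Df u; have [dDv /(_ u) cDv] := Df v.
apply/eqP; rewrite -subr_eq0 -normr_eq0; apply/eqP/le_anti.
rewrite normr_ge0 andbT; apply/ler_addgt0Pl => e e0; rewrite addr0.
have e2 : 0 < e / 2 by rewrite divr_gt0.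
have Hu : \forall y \near x, `|'D_v ('D_u f) x - 'D_v ('D_u f) y| < e / 2.
  by have /cvgrPdist_lt /(_ _ e2) := cDu _ Ax.
have Hv : \forall y \near x, `|'D_u ('D_v f) x - 'D_u ('D_v f) y| < e / 2.
  by have /cvgrPdist_lt /(_ _ e2) := cDv _ Ax.
have HA : \forall y \near x, A y by exact: open_nbhs_nbhs.
have [d /= d0 dH] : exists2 d : R, 0 < d & forall y, `|x - y| < d ->
    [/\ `|'D_v ('D_u f) x - 'D_v ('D_u f) y| < e / 2,
        `|'D_u ('D_v f) x - 'D_u ('D_v f) y| < e / 2 & A y].
  have /nbhs_normP[d /= d0 dH] : \forall y \near x,
    [/\ `|'D_v ('D_u f) x - 'D_v ('D_u f) y| < e / 2,
        `|'D_u ('D_v f) x - 'D_u ('D_v f) y| < e / 2 & A y].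
    by apply: filterS3 Hu Hv HA => y; exact: And3.
  by exists d => // y xy; exact: dH.
have [h h0 hd] : exists2 h : R, 0 < h & forall s t : R,
    0 <= s <= h -> 0 <= t <= h -> `|x - (s *: u + (t *: v + x))| < d.
  (* The step [d / (2 m)] keeps the parallelogram inside the ball of radius [d]; the summand [1]
     keeps [m] positive when [u = v = 0]. *)
  have [m m0 Em] : exists2 m : R, 0 < m & m = `|u| + `|v| + 1.
    by exists (`|u| + `|v| + 1) => //; rewrite ltr_wpDl// addr_ge0.
  exists (d / (2 * m)) => [|s t]; first by rewrite divr_gt0// mulr_gt0.
  set h := d / (2 * m) => /andP[s0 sh] /andP[t0 th].
  have -> : x - (s *: u + (t *: v + x)) = - (s *: u + t *: v).
    by rewrite addrA opprD addrCA subrr addr0.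
  rewrite normrN (le_lt_trans (ler_normD _ _))// !normrZ !ger0_norm//.
  rewrite (@le_lt_trans _ _ (h * m))//.
    rewrite Em !mulrDr mulr1 -addrA lerD ?ler_wpM2r//.
    by rewrite (le_trans (ler_wpM2r _ th))// lerDl (le_trans t0).
  by rewrite /h invfM mulrA -mulrA mulVf ?gt_eqF// mulr1 ltr_pdivrMr// ltr_pMr// ltr1n.
have hd' (s t : R) : 0 <= s <= h -> 0 <= t <= h ->
    `|x - (s *: v + (t *: u + x))| < d.
  by move=> *; rewrite addrCA; exact: hd.
have [s [t [sh th E1]]] := @second_difference f A x u v h h0
  (fun s t sh th => let: And3 _ _ Ay := dH _ (hd s t sh th) in Ay) df dDu.
have [s' [t' [sh' th' E2]]] := @second_difference f A x v u h h0
  (fun s t sh th => let: And3 _ _ Ay := dH _ (hd' s t sh th) in Ay) df dDv.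
have E : 'D_v ('D_u f) (s *: u + (t *: v + x)) =
         'D_u ('D_v f) (s' *: v + (t' *: u + x)).
  apply: (mulfI (lt0r_neq0 h0)); apply: (mulfI (lt0r_neq0 h0)).
  apply: (etrans (esym E1)); apply: (etrans _ E2).
  rewrite (addrCA (h *: v)).
  rewrite -[LHS]addrA -[RHS]addrA; congr (_ + _); rewrite !opprB.
  by rewrite addrCA [RHS]addrCA; congr (_ + _); rewrite addrC.
have [H1 _ _] := dH _ (hd _ _ sh th).
have [_ H2 _] := dH _ (hd' _ _ sh' th').
apply: (le_trans (ler_distD ('D_v ('D_u f) (s *: u + (t *: v + x))) _ _)).
rewrite -E in H2; rewrite distrC in H1.
apply: (le_trans (lerD (ltW H2) (ltW H1))).
by rewrite -splitr.
Qed.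

Lemma derive0_ball_const f x (e : R) :
  (forall y, `|x - y| < e -> differentiable f y) ->
  (forall y u, `|x - y| < e -> 'D_u f y = 0) ->
  forall y, `|x - y| < e -> f y = f x.
Proof.
move=> df Df y xy; have [->//|yx] := eqVneq y x.
have Hs s : 0 <= s <= 1 -> `|x - (s *: (y - x) + x)| < e.
  move=> /andP[s0 s1]; rewrite opprD addrCA subrr addr0 normrN normrZ.
  rewrite ger0_norm// (le_lt_trans _ xy)// distrC ler_piMl//.
have [s sh] := @mean_value_line f x (y - x) 1 ltr01 (fun s h => df _ (Hs s h)).
by rewrite Df ?Hs// mulr0 scale1r subrK => /eqP; rewrite subr_eq0 => /eqP.
Qed.

End MeanValue.

(** * Bump functions *)

Section Bump.
Context (R : realType).

(** This is [x^-m e^(-1/x)] continued by 0. The exponent [m] is carried along because the derivative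
    of [flat m] is a combination of [flat m.+2] and [flat m.+1]. *)
Definition flat (m : nat) (x : R) : R :=
  if 0 < x then x^-1 ^+ m * expR (- x^-1) else 0.

(** At [1/x] the exponential dominates the term of degree [m + 2] of its series. The quadratic bound
    gives derivative 0 at the origin. *)
Lemma flat_bound m x : `|flat m x| <= m.+2`!%:R * x ^+ 2.
Proof.
rewrite /flat; case: ifPn => x0; last first.
  by rewrite normr0 mulr_ge0// ?ler0n// sqr_ge0.
have y0 : 0 < x^-1 by rewrite invr_gt0.
rewrite ger0_norm; last by rewrite mulr_ge0 ?expR_ge0// exprn_ge0// ltW.
have := expR_ge1Dxn m.+1 (ltW y0).
have f0 : 0 < (m.+2`!%:R : R) by rewrite ltr0n fact_gt0.
have p0 : 0 < x^-1 ^+ m.+2 by rewrite exprn_gt0.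
move=> E; rewrite expRN.
apply: (@le_trans _ _ (x^-1 ^+ m * (x^-1 ^+ m.+2 / m.+2`!%:R)^-1)).
  rewrite ler_wpM2l ?exprn_ge0 ?(ltW y0)// lef_pV2 ?posrE ?expR_gt0 ?divr_gt0//.
  by apply: le_trans E; rewrite lerDr.
rewrite invf_div mulrCA -[m.+2]addn2 exprD invfM mulrA -exprVn invrK.
by rewrite -mulrA [x^-1 ^+ m * _]mulrA -exprMn mulVf ?gt_eqF// expr1n mul1r -exprVn invrK.
Qed.

Lemma flat_derive (m : nat) (x : R) :
  is_derive x 1 (flat m) (flat m.+2 x - m%:R * flat m.+1 x).
Proof.
have [x0|x0|->] := ltgtP x 0.
- have e : \forall y \near x, (cst 0 : R -> R) y = flat m y.
    near=> y; rewrite /flat ltNge ltW//; near: y; exact: lt_nbhsl.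
  rewrite /flat ltNge ltW//= mulr0 subr0.
  exact: near_eq_is_derive e _.
- have e : \forall y \near x,
      ((fun y => y^-1) ^+ m * (expR \o (fun y => - y^-1))) y = flat m y.
    near=> y; rewrite /flat ifT; last by near: y; exact: lt_nbhsr.
    by rewrite !fctE.
  apply: near_eq_is_derive e _.
  have xn0 : x != 0 by rewrite gt_eqF.
  have dV : is_derive x 1 (fun y : R => y^-1) (- (x^-1 ^+ 2)).
    apply: DeriveDef; first exact: (@derivableV _ _ id).
    by rewrite (@deriveV _ _ id)// derive_id [_%:A]mulr1 exprVn.
  have dE : is_derive x 1 (expR \o (fun y : R => - y^-1))
      (x^-1 ^+ 2 * expR (- x^-1)).
    have dN : is_derive x 1 (fun y : R => - y^-1) (x^-1 ^+ 2).
      by have := is_deriveN dV; rewrite opprK.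
    by have := @is_derive1_comp R (@expR R) (fun y => - y^-1) x _ _ (is_derive_expR _) dN; rewrite mulrC.
  rewrite /flat x0; case: m => [|m].
    rewrite expr0 mul0r subr0 mul1r.
    by apply: is_derive_eq; rewrite ?fctE.
  apply: is_derive_eq.
  rewrite /= !fctE /=.
  rewrite /GRing.scale/= !exprS -natr1.
  ring.
(* At 0 the difference quotient is at most [(m+2)! |h|] by [flat_bound]. *)
- rewrite /flat ltxx mulr0 subr0.
  have C : (fun h : R => h^-1 *: ((flat m \o shift 0) (h *: 1) - flat m 0)) @ 0^' --> (0 : R).
    apply/cvgr0Pnorm_lt => eps eps0.
    have f0 : 0 < (m.+2`!%:R : R) by rewrite ltr0n fact_gt0.
    near=> h.
    have hn0 : h != 0 by near: h; exact: nbhs_dnbhs_neq.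
    have hs : `|h| < eps / m.+2`!%:R.
      by near: h; apply: dnbhs0_lt; rewrite divr_gt0.
    rewrite /= {2}/flat ltxx subr0 addr0 [h%:A]mulr1 normrM normfV.
    rewrite ltr_pdivrMl ?normr_gt0// (le_lt_trans (flat_bound _ _))//.
    rewrite -real_normK ?num_real// expr2 mulrCA ltr_pM2l ?normr_gt0//.
    by rewrite mulrC -ltr_pdivlMr.
  apply: DeriveDef; first by apply/cvg_ex; exists 0.
  exact: cvg_lim C.
Unshelve. all: by end_near. Qed.

(** The induction on [k] runs over all [m] at once, since differentiating raises [m]. *)
Lemma Ck_flat (V : normedModType R) k (A : set V) (f : V -> R) m : open A ->
  Ck k A f -> Ck k A (fun x => flat m (f x)).
Proof.
have df (y : R) j : differentiable (flat j) y.
  by apply/derivable1_diffP; have [] := flat_derive j y.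
move=> oA; elim: k m => [m cf x Ax|k IH m Cf].
  apply: (@continuous_comp _ _ _ f (flat m)); first exact: cf.
  exact: differentiable_continuous.
have [dF Df] := Cf.
split=> [x Ax|v]; first by apply: (@differentiable_comp _ _ _ _ f); [exact: dF|exact: df].
apply: (@Ck_ext _ _ _ _ _ (fun x => 'D_v f x *
  (flat m.+2 (f x) + (- m%:R) * flat m.+1 (f x)))) => //.
  move=> x Ax; rewrite [RHS](@derive_chain _ _ _ _ f (flat m)); last 2 first.
  - exact: dF.
  - exact: df.
  rewrite [RHS]deriveE// diff1E// derive1E.
  by have [_ ->] := flat_derive m (f x); rewrite mulNr.
apply: Ck_mul => //; first exact: Df.
apply: Ck_add => //; first exact: IH (CkS Cf).
by apply: Ck_mul => //; [exact: Ck_cst|exact: IH (CkS Cf)].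
Qed.

Lemma Ck_id n k (A : set 'rV[R]_n) : Ck k A id.
Proof.
case: k => [x _|k]; first exact: cvg_id.
split=> [x _|v]; first exact: ex_diff.
rewrite (_ : 'D_v id = fun=> v); first exact: Ck_cst.
by apply/funext => x; exact: derive_id.
Qed.

Lemma rV_norm_lt n (x : 'rV[R]_n) (e : R) : 0 < e ->
  (forall i, `|x ord0 i| < e) -> `|x| < e.
Proof.
move=> e0 H; rewrite [ltLHS]/Num.Def.normr/= mx_normrE bigmax_lt// => -[i j] _ /=.
by rewrite (ord1 i).
Qed.

(** The function is [flat 0] of [e^2] minus the squared Euclidean distance to [x0], normalised at
    [x0]. That square is polynomial, and the Euclidean distance dominates the maximum norm that
    defines the balls. *)
Lemma bump_exists n (x0 : 'rV[R]_n) (e : R) : 0 < e ->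
  exists F : 'rV[R]_n -> R,
    [/\ smooth_on setT F, F x0 = 1 & forall x, F x != 0 -> `|x0 - x| < e].
Proof.
move=> e0.
have fe0 : 0 < flat 0 (e ^+ 2).
  by rewrite /flat exprn_gt0// mulr_gt0 ?expR_gt0// expr0.
pose r (x : 'rV[R]_n) : R := e ^+ 2 + -1 * \sum_(i < n)
  (x ord0 i - x0 ord0 i) * (x ord0 i - x0 ord0 i).
exists (fun x => flat 0 (r x) * (flat 0 (e ^+ 2))^-1); split.
- move=> k; apply: Ck_mul; [exact: openT| |exact: Ck_cst].
  apply: Ck_flat; first exact: openT.
  apply: Ck_add; [exact: openT|exact: Ck_cst|].
  apply: Ck_mul; [exact: openT|exact: Ck_cst|].
  apply: Ck_sum => [|i _]; first exact: openT.
  have C : Ck k setT (fun x : 'rV[R]_n => x ord0 i - x0 ord0 i).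
    apply: Ck_add; [exact: openT| |exact: Ck_cst].
    by apply: (@Ck_coord _ _ _ _ _ id); [exact: openT|exact: Ck_id].
  by apply: Ck_mul => //; exact: openT.
- rewrite /r big1 ?mulr0 ?addr0 ?mulfV ?gt_eqF// => i _.
  by rewrite subrr mulr0.
- move=> x; rewrite mulf_eq0 negb_or => /andP[+ _].
  rewrite /flat; case: ifPn => [rx _|]; last by rewrite eqxx.
  apply: rV_norm_lt => // i.
  rewrite !mxE distrC -ltr_sqr ?nnegrE ?normr_ge0 ?(ltW e0)//.
  rewrite real_normK ?num_real//.
  move: rx; rewrite /r mulN1r subr_gt0; apply: le_lt_trans.
  rewrite (bigD1 i)//= expr2 lerDl sumr_ge0// => j _.
  by rewrite -expr2 sqr_ge0.
Qed.

End Bump.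

(** * Charts and smooth fields *)

Lemma derive_dirB (R : realType) (V W : normedModType R) (f : V -> W) x u v :
  differentiable f x -> 'D_(u - v) f x = 'D_u f x - 'D_v f x.
Proof. by move=> df; rewrite !deriveE// linearB. Qed.

(** With [D_(w y) F] written as the sum of [w_i d_i F], the product rule and the symmetry of second
    derivatives give the two terms. *)
Lemma derive_derive_along (R : realType) n (A : set 'rV[R]_n)
    (F : 'rV[R]_n -> R) (w : 'rV[R]_n -> 'rV[R]_n) x z :
  open A -> A x -> smooth_on A F -> smooth_on A w ->
  'D_z (fun y => 'D_(w y) F y) x = 'D_('D_z w x) F x + 'D_(w x) ('D_z F) x.
Proof.
move=> oA Ax sF sw.
have e : \forall y \near x,
    (\sum_(i < n) ((fun y => w y ord0 i) * 'D_(delta_mx ord0 i) F)) y = 'D_(w y) F y.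
  apply: open_near oA Ax _ => y Ay.
  rewrite [RHS]derive_dir; last exact: smooth_on_differentiable sF Ay.
  by rewrite fct_sumE.
rewrite -(near_eq_derive _ e).
have dF i : differentiable ('D_(delta_mx ord0 i) F) x.
  exact: smooth_on_differentiable (smooth_on_derive _ sF) Ax.
have dw i : differentiable (fun y => w y ord0 i) x.
  apply: (@smooth_on_differentiable _ _ _ A) => // k.
  exact: Ck_coord oA (sw k).
rewrite derive_sum; last by move=> i; apply: derivableM; exact: diff_derivable.
rewrite [X in _ = X + _]derive_dir; last exact: smooth_on_differentiable sF Ax.
rewrite [X in _ = _ + X]derive_dir; last first.
  exact: smooth_on_differentiable (smooth_on_derive _ sF) Ax.
rewrite -big_split/=; apply: eq_bigr => i _.
rewrite deriveM; [|exact: diff_derivable..].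
rewrite (schwarz _ _ oA Ax (sF 2%N)) addrC derive_coord.
  by congr (_ + _); rewrite /GRing.scale /= mulrC.
exact: smooth_on_differentiable sw Ax.
Qed.

Section Charts.
Context (R : realType) (n : nat) (M : smooth_manifold R n).
Implicit Types (p q r y : M) (X Y Z U V : vfield M).

Notation cdm p := (cdom (chart_at p)).
Notation cim p := (cimg (chart_at p)).

Lemma coord_cimg p y : cdm p y -> cim p (coord p y).
Proof. by exists y. Qed.

Lemma coordK p y : cdm p y -> param p (coord p y) = y.
Proof. exact: cmapK. Qed.

Lemma param_dom p x : cim p x -> cdm p (param p x).
Proof. by move=> [y py <-]; rewrite coordK. Qed.

Lemma paramK p x : cim p x -> coord p (param p x) = x.
Proof. by move=> [y py <-]; rewrite coordK. Qed.

Lemma param_continuous p x : cim p x -> {for x, continuous (param p)}.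
Proof.
move=> px; have := @cinv_continuous _ _ _ (chart_at p).
rewrite continuous_open_subspace; last exact: cimg_open.
by apply; rewrite inE.
Qed.

Lemma coord_continuous p y : cdm p y -> {for y, continuous (coord p)}.
Proof.
move=> py; have := @cmap_continuous _ _ _ (chart_at p).
rewrite continuous_open_subspace; last exact: cdom_open.
by apply; rewrite inE.
Qed.

Definition overlap p q : set 'rV[R]_n := coord p @` (cdm p `&` cdm q).

Lemma overlapP p q x : overlap p q x <-> cim p x /\ cdm q (param p x).
Proof.
split=> [[y [py qy] <-]|[px qx]]; first by rewrite coordK//; split => //; exists y.
by exists (param p x); [split => //; exact: param_dom|exact: paramK].
Qed.

Lemma overlap_coord p q y : cdm p y -> cdm q y -> overlap p q (coord p y).
Proof. by move=> py qy; exists y. Qed.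

Lemma overlap_open p q : open (overlap p q).
Proof.
have -> : overlap p q = cim p `&` param p @^-1` cdm q.
  by apply/seteqP; split=> x; rewrite /= => /overlapP.
rewrite openE => x [px qx].
apply: filterI; first by apply: open_nbhs_nbhs; split => //; exact: cimg_open.
apply: (param_continuous px); apply: open_nbhs_nbhs; split => //; exact: cdom_open.
Qed.

Lemma transition_smooth p q : smooth_on (overlap p q) (coord q \o param p).
Proof. exact: chart_at_compat. Qed.

Lemma transition_diff p q y : cdm p y -> cdm q y ->
  differentiable (coord q \o param p) (coord p y).
Proof.
move=> py qy; apply: smooth_on_differentiable (transition_smooth p q) _.
exact: overlap_coord.
Qed.

(* The differential at [y] of the transition map from chart [p] to chart [q]. *)
Definition tmap p q y (v : 'rV[R]_n) : 'rV[R]_n :=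
  'D_v (coord q \o param p) (coord p y).

(** Near the point [F \o param p] factors through the transition map, so this is the chain rule.
    Both the cocycle rule for [tmap] and the chart independence of [vf_app] come from it. *)
Lemma derive_transport (W : normedModType R) (F : M -> W) p q y v :
  cdm p y -> cdm q y -> differentiable (F \o param q) (coord q y) ->
  differentiable (F \o param p) (coord p y) /\
  'D_v (F \o param p) (coord p y) =
  'D_(tmap p q y v) (F \o param q) (coord q y).
Proof.
move=> py qy dF.
have e : \forall x \near coord p y,
    ((F \o param q) \o (coord q \o param p)) x = (F \o param p) x.
  apply: open_near (@overlap_open p q) (overlap_coord py qy) _ => x.
  by move=> /overlapP[px qx] /=; rewrite coordK.
have dc := transition_diff py qy.
have dF' : differentiable (F \o param q) ((coord q \o param p) (coord p y)).
  by rewrite /= coordK.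
split; first exact: near_eq_differentiable e (differentiable_comp dc dF').
rewrite -(near_eq_derive _ e) derive_chain//.
by rewrite [(coord q \o _) _]/= coordK.
Qed.

Lemma tmap_id p y v : cdm p y -> tmap p p y v = v.
Proof.
move=> py; rewrite /tmap.
have e : \forall x \near coord p y, id x = (coord p \o param p) x.
  apply: open_near (@cimg_open _ _ _ _) (coord_cimg py) _ => x px /=.
  by rewrite paramK.
by rewrite -(near_eq_derive _ e) derive_id.
Qed.

Lemma tmap_comp p q r y v : cdm p y -> cdm q y -> cdm r y ->
  tmap q r y (tmap p q y v) = tmap p r y v.
Proof.
move=> py qy ry.
rewrite [RHS]/tmap.
by have [_ ->] := derive_transport v py qy (transition_diff qy ry).
Qed.

Lemma tmap_linear p q y a u v : cdm p y -> cdm q y ->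
  tmap p q y (a *: u + v) = a *: tmap p q y u + tmap p q y v.
Proof.
by move=> py qy; rewrite /tmap !deriveE ?linearP//; exact: transition_diff.
Qed.

Lemma tmap0 p q y : cdm p y -> cdm q y -> tmap p q y 0 = 0.
Proof. by move=> py qy; rewrite /tmap derive0. Qed.

Lemma tmapD p q y u v : cdm p y -> cdm q y ->
  tmap p q y (u + v) = tmap p q y u + tmap p q y v.
Proof. by move=> py qy; rewrite -{1}(scale1r u) tmap_linear// scale1r. Qed.

Lemma tmapZ p q y a u : cdm p y -> cdm q y ->
  tmap p q y (a *: u) = a *: tmap p q y u.
Proof. by move=> py qy; rewrite -(addr0 (_ *: _)) tmap_linear// tmap0// addr0. Qed.

Lemma tmap_sum p q y (I : Type) (s : seq I) (P : pred I) (f : I -> 'rV[R]_n) :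
  cdm p y -> cdm q y ->
  tmap p q y (\sum_(i <- s | P i) f i) = \sum_(i <- s | P i) tmap p q y (f i).
Proof.
move=> py qy; apply: (big_morph (tmap p q y)); last exact: tmap0.
by move=> u v; exact: tmapD.
Qed.

Lemma tmapK p q y v : cdm p y -> cdm q y -> tmap q p y (tmap p q y v) = v.
Proof. by move=> py qy; rewrite tmap_comp// tmap_id. Qed.

(** * Vector fields in charts and their action on functions *)

Lemma dom_self p : cdm p p. Proof. exact: chart_at_dom. Qed.

Lemma vf_repE X q x : vf_rep X q x = tmap (param q x) q (param q x) (X (param q x)).
Proof. by []. Qed.

Lemma vf_rep_coord X q y : cdm q y -> vf_rep X q (coord q y) = tmap y q y (X y).
Proof. by move=> qy; rewrite vf_repE coordK. Qed.

Lemma vf_rep_self X p : vf_rep X p (coord p p) = X p.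
Proof. by rewrite vf_rep_coord ?tmap_id//; exact: dom_self. Qed.

Lemma smooth_fun_diff (f : M -> R) q y : smooth_fun f -> cdm q y ->
  differentiable (f \o param q) (coord q y).
Proof.
by move=> sf qy; apply: smooth_on_differentiable (sf q) _; exact: coord_cimg.
Qed.

Lemma vf_appE X (f : M -> R) q y : smooth_fun f -> cdm q y ->
  vf_app X f y = 'D_(vf_rep X q (coord q y)) (f \o param q) (coord q y).
Proof.
move=> sf qy; rewrite vf_rep_coord// /vf_app.
by have [_ ->] := derive_transport (X y) (dom_self y) qy (smooth_fun_diff sf qy).
Qed.

Lemma smooth_fun_cst (c : R) : smooth_fun (fun _ : M => c).
Proof. by move=> q k; exact: Ck_cst. Qed.

Lemma smooth_fun_add (f g : M -> R) : smooth_fun f -> smooth_fun g ->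
  smooth_fun (fun p => f p + g p).
Proof. by move=> sf sg q k; apply: Ck_add; [exact: cimg_open|exact: sf|exact: sg]. Qed.

Lemma smooth_fun_mul (f g : M -> R) : smooth_fun f -> smooth_fun g ->
  smooth_fun (fun p => f p * g p).
Proof. by move=> sf sg q k; apply: Ck_mul; [exact: cimg_open|exact: sf|exact: sg]. Qed.

Lemma smooth_vf_add X Y : smooth_vf X -> smooth_vf Y -> smooth_vf (vf_add X Y).
Proof.
move=> sX sY q k.
apply: (@Ck_ext _ _ _ _ _ (fun x => vf_rep X q x + vf_rep Y q x)).
- exact: cimg_open.
- move=> x qx; rewrite !vf_repE tmapD//; [exact: dom_self|exact: param_dom].
- by apply: Ck_add; [exact: cimg_open|exact: sX|exact: sY].
Qed.

Lemma Ck_scale (V : normedModType R) k (A : set V) (s : V -> R)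
    (f : V -> 'rV[R]_n) : open A ->
  Ck k A s -> Ck k A f -> Ck k A (fun x => s x *: f x).
Proof.
move=> oA cs cf; apply: Ck_row => // i.
apply: (@Ck_ext _ _ _ _ _ (fun x => s x * f x ord0 i)) => //.
  by move=> x _; rewrite mxE.
by apply: Ck_mul => //; exact: Ck_coord.
Qed.

Lemma smooth_vf_scale (f : M -> R) X : smooth_fun f -> smooth_vf X ->
  smooth_vf (vf_scale f X).
Proof.
move=> sf sX q k.
apply: (@Ck_ext _ _ _ _ _ (fun x => (f \o param q) x *: vf_rep X q x)).
- exact: cimg_open.
- move=> x qx; rewrite !vf_repE -tmapZ//; [exact: dom_self|exact: param_dom].
- by apply: Ck_scale; [exact: cimg_open|exact: sf|exact: sX].
Qed.

Lemma vf_subE X Y : vf_sub X Y = vf_add X (vf_scale (fun=> -1) Y).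
Proof. by apply/funext => p; rewrite /vf_sub /vf_add /vf_scale scaleN1r. Qed.

Lemma smooth_vf_sub X Y : smooth_vf X -> smooth_vf Y -> smooth_vf (vf_sub X Y).
Proof.
move=> sX sY; rewrite vf_subE; apply: smooth_vf_add => //.
by apply: smooth_vf_scale => //; exact: smooth_fun_cst.
Qed.

Lemma smooth_fun_app X (f : M -> R) : smooth_vf X -> smooth_fun f ->
  smooth_fun (vf_app X f).
Proof.
move=> sX sf q k.
apply: (@Ck_ext _ _ _ _ _ (fun x => \sum_(i < n)
   vf_rep X q x ord0 i * 'D_(delta_mx ord0 i) (f \o param q) x)).
- exact: cimg_open.
- move=> x qx /=.
  rewrite (vf_appE X sf (param_dom qx)) paramK// [RHS]derive_dir//.
  by apply: smooth_on_differentiable (sf q) qx.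
- apply: Ck_sum => [|i _]; first exact: cimg_open.
  apply: Ck_mul; [exact: cimg_open| |exact: smooth_on_derive (sf q) _].
  by apply: Ck_coord; [exact: cimg_open|exact: sX].
Qed.

(** In a chart, [X (Y f)] is the derivative of [f] along [D_X Y] plus a second derivative of [f]
    along [X] and [Y]; the latter is symmetric and cancels. *)
Lemma lie_bracket_app X Y (f : M -> R) p :
  smooth_vf X -> smooth_vf Y -> smooth_fun f ->
  vf_app (lie_bracket X Y) f p = vf_app X (vf_app Y f) p - vf_app Y (vf_app X f) p.
Proof.
move=> sX sY sf.
have px0 : cim p (coord p p) by exact/coord_cimg/dom_self.
have second Z W : smooth_vf Z -> smooth_vf W ->
    vf_app Z (vf_app W f) p =
    'D_('D_(Z p) (vf_rep W p) (coord p p)) (f \o param p) (coord p p) +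
    'D_(W p) ('D_(Z p) (f \o param p)) (coord p p).
  move=> sZ sW; rewrite -[in X in _ = _ + X](vf_rep_self W).
  rewrite -(derive_derive_along _ (@cimg_open _ _ _ _) px0 (sf p) (sW p)).
  apply: near_eq_derive.
  apply: open_near (@cimg_open _ _ _ _) px0 _ => x px /=.
  by rewrite (vf_appE W sf (param_dom px)) paramK.
rewrite !second// {1}/vf_app /lie_bracket.
have dF : differentiable (f \o param p) (coord p p).
  exact: smooth_on_differentiable (sf p) px0.
rewrite (derive_dirB _ _ dF).
rewrite (schwarz (X p) (Y p) (@cimg_open _ _ _ _) px0 (sf p 2%N)).
by move: ('D_(Y p) _ _) => s; rewrite opprD addrACA subrr addr0.
Qed.

End Charts.

(** * Global extension and tensoriality *)

Section MatrixCalculus.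
Context (R : realType) (V : normedModType R) (A : set V) (k : nat).
Hypothesis oA : open A.

Lemma Ck_det n (G : V -> 'M[R]_n) : (forall i j, Ck k A (fun x => G x i j)) ->
  Ck k A (fun x => \det (G x)).
Proof.
move=> CG; rewrite /determinant.
apply: Ck_sum => // s _; apply: Ck_mul => //; first exact: Ck_cst.
exact: Ck_prod.
Qed.

(** By Cramer's rule the entries are cofactors divided by the determinant. *)
Lemma Ck_invmx n (G : V -> 'M[R]_n) i j :
  (forall i j, Ck k A (fun x => G x i j)) ->
  (forall x, A x -> G x \in unitmx) -> Ck k A (fun x => invmx (G x) i j).
Proof.
move=> CG uG.
apply: (@Ck_ext _ _ _ _ _ (fun x => (\det (G x))^-1 * cofactor (G x) j i)) => //.
  by move=> x Ax; rewrite /invmx uG// !mxE.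
apply: Ck_mul => //.
  apply: Ck_inv => //; last exact: Ck_det.
  by move=> x /uG; rewrite unitmxE unitfE.
rewrite /cofactor; apply: Ck_mul => //; first exact: Ck_cst.
apply: Ck_det => i' j'.
by apply: Ck_ext (CG (lift j i') (lift i j')) => // x _; rewrite !mxE.
Qed.

End MatrixCalculus.

(** The components of [z] in the rows of [E] are [z E^-1]; times the Gram matrix [E G E^T] they
    become the products of [z] with the rows. *)
Lemma frame_expansion (F : fieldType) n (E G : 'M[F]_n) (z : 'rV[F]_n) :
  G \in unitmx -> E \in unitmx ->
  z *m G *m E^T *m invmx (E *m G *m E^T) *m E = z.
Proof.
move=> uG uE.
have -> : z *m G *m E^T = z *m invmx E *m (E *m G *m E^T).
  by rewrite !mulmxA mulmxKV.
by rewrite mulmxK ?mulmxKV// !unitmx_mul unitmx_tr uE uG.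
Qed.

(** * Cut-off functions and fields extended from a chart *)

Section Extension.
Context (R : realType) (n : nat) (M : smooth_manifold R n).
Implicit Types (p q r y : M) (X Y Z U V : vfield M).

Notation cdm p := (cdom (chart_at p)).
Notation cim p := (cimg (chart_at p)).

Definition supported_in (p : M) (K : set 'rV[R]_n) (F : 'rV[R]_n -> R) :=
  [/\ compact K, K `<=` cim p & forall x, ~ K x -> F x = 0].

(** The image is compact, hence closed in a Hausdorff space; extensions by 0 vanish on its open
    complement. *)
Lemma closed_param_compact p (K : set 'rV[R]_n) : compact K -> K `<=` cim p ->
  closed (param p @` K).
Proof.
move=> cK Kp; apply: compact_closed; first exact: mspace_hausdorff.
apply: continuous_compact => //.
apply: continuous_subspaceW Kp _.
exact: (@cinv_continuous _ _ _ (chart_at p)).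
Qed.

(** A point of chart [q] either lies in chart [p], where the overlap serves, or has a neighbourhood
    [B] that misses the closed image of [K], where [G] is 0. *)
Lemma smooth_on_extension (W : normedModType R) p q (K : set 'rV[R]_n)
    (G : 'rV[R]_n -> W) : compact K -> K `<=` cim p ->
  (forall x, cim q x -> ~ (cdm p (param q x) /\ K (coord p (param q x))) ->
     G x = 0) ->
  smooth_on (overlap q p) G -> smooth_on (cim q) G.
Proof.
move=> cK Kp G0 sG; apply: smooth_on_local => x qx.
have [px|npx] := pselect (cdm p (param q x)).
  by exists (overlap q p); split => //; apply/overlapP.
pose B := cim q `&` param q @^-1` (~` (param p @` K)).
have oB : open B.
  rewrite openE => z [qz Kz]; apply: filterI.
    by apply: open_nbhs_nbhs; split => //; exact: cimg_open.
  apply: (param_continuous qz); apply: open_nbhs_nbhs; split => //.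
  by apply: closed_openC; exact: closed_param_compact.
exists B; split.
  split => // -[z Kz zx]; apply: npx; rewrite -zx; exact/param_dom/Kp.
move=> k; apply: Ck_ext (Ck_cst k B (0 : W)) => // z [qz Kz].
rewrite G0// => -[pz Kz']; apply: Kz.
by exists (coord p (param q z)) => //; rewrite coordK.
Qed.

(* Local functions and coordinate fields of the chart [p], multiplied by the cut-off
   [F] and extended by [0] outside the chart. *)
Definition ext_fun p (F : 'rV[R]_n -> R) : M -> R :=
  fun y => if `[< cdm p y >] then F (coord p y) else 0.

Definition ext_field p (F : 'rV[R]_n -> R) (i : 'I_n) : vfield M :=
  fun y => if `[< cdm p y >]
           then F (coord p y) *: tmap p y y (delta_mx ord0 i) else 0.

Lemma smooth_ext_fun p K (F : 'rV[R]_n -> R) : supported_in p K F ->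
  smooth_on (cim p) F -> smooth_fun (ext_fun p F).
Proof.
move=> [cK Kp F0] sF q.
apply: (smooth_on_extension cK Kp) => [x qx|k].
  rewrite /ext_fun /=; case: asboolP => // px H.
  by apply: F0 => Kx; apply: H.
apply: (@Ck_ext _ _ _ _ _ (F \o (coord p \o param q))).
- exact: overlap_open.
- by move=> x /overlapP[qx px]; rewrite /ext_fun /=; case: asboolP.
- apply: (Ck_compR _ (@cimg_open _ _ _ (chart_at p))).
  + exact: overlap_open.
  + by move=> x /overlapP[qx px] /=; exact: coord_cimg.
  + exact: transition_smooth.
  + exact: sF.
Qed.

Lemma smooth_ext_field p K (F : 'rV[R]_n -> R) i : supported_in p K F ->
  smooth_on (cim p) F -> smooth_vf (ext_field p F i).
Proof.
move=> [cK Kp F0] sF q.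
apply: (smooth_on_extension cK Kp) => [x qx|k].
  rewrite vf_repE /ext_field /=; case: asboolP => [px H|_ _].
    rewrite F0 ?scale0r ?tmap0//; [exact: dom_self|exact: param_dom|].
    by move=> Kx; apply: H.
  by rewrite tmap0//; [exact: dom_self|exact: param_dom].
have oqp := @overlap_open _ _ M q p.
have sqp := @transition_smooth _ _ M q p k.
(* In chart [q] the field is the cut-off times the [i]-th partial derivative of the transition map
   out of [p], both evaluated at the coordinates in [p]. *)
apply: (@Ck_ext _ _ _ _ _ (fun x => (F \o (coord p \o param q)) x *:
  ('D_(delta_mx ord0 i) (coord q \o param p) \o (coord p \o param q)) x)) => //.
  move=> x /overlapP[qx px]; rewrite vf_repE /ext_field /=; case: asboolP => // _.
  have yx := param_dom qx.
  rewrite tmapZ//; last exact: dom_self.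
  by rewrite tmap_comp//; exact: dom_self.
apply: Ck_scale => //.
  apply: (Ck_compR oqp (@cimg_open _ _ _ (chart_at p)) _ sqp (sF k)).
  by move=> x /overlapP[qx px] /=; exact: coord_cimg.
apply: (Ck_comp oqp (@overlap_open _ _ M p q) _ sqp).
  by move=> x /overlapP[qx px] /=; apply: overlap_coord => //; exact: param_dom.
exact: smooth_on_derive (@transition_smooth _ _ M p q) k.
Qed.

Lemma cutoff_exists p y : cdm p y -> exists K F,
  [/\ supported_in p K F, smooth_on setT F & F (coord p y) = 1].
Proof.
move=> py.
have /nbhs_normP[e /= e0 He] : nbhs (coord p y) (cim p).
  by apply: open_nbhs_nbhs; split; [exact: cimg_open|exact: coord_cimg].
(* With half the radius, the closed ball is a compact set inside the open ball of radius [e]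
   contained in the chart image. *)
have e20 : 0 < e / 2 by rewrite divr_gt0.
have [F [sF F1 FK]] := bump_exists (coord p y) e20.
exists [set x | `|coord p y - x| <= e / 2], F; split => //; split.
- apply: bounded_closed_compact; last exact: closed_closed_ball_.
  exists (`|coord p y| + e / 2); split; first exact: num_real.
  move=> t ht x /= xe; rewrite (le_trans _ (ltW ht))//.
  rewrite -[x in leLHS](subKr (coord p y)) (le_trans (ler_normB _ _))// lerD2l//.
- move=> x /= xe; apply: He => /=.
  by rewrite (le_lt_trans xe)// ltr_pdivrMr// ltr_pMr// ltr1n.
- move=> x /= xK; apply/eqP; apply: contrapT => /negP Fx; apply: xK.
  exact/ltW/FK.
Qed.

Lemma supported_inM p K (F G : 'rV[R]_n -> R) :
  supported_in p K F -> supported_in p K (fun x => F x * G x).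
Proof. by move=> [? ? F0]; split => // x Kx; rewrite F0// mul0r. Qed.

(* Both factors of a component times a coordinate field are cut off, so each extends
   globally. *)
Lemma ext_decomposition p (F : 'rV[R]_n -> R) X y :
  ext_fun p F y ^+ 2 *: X y = \sum_(i < n)
    ext_fun p (fun x => F x * vf_rep X p x ord0 i) y *: ext_field p F i y.
Proof.
rewrite /ext_fun /ext_field; case: asboolP => py; last first.
  by rewrite expr0n scale0r big1// => i _; rewrite scale0r.
have yy := dom_self y.
under eq_bigr => i _ do rewrite scalerA -mulrA [_ * F _]mulrC mulrA -scalerA -tmapZ//.
by rewrite -scaler_sumr -tmap_sum// -row_sum_delta vf_rep_coord// tmapK// expr2.
Qed.

Lemma smooth_vf0 : smooth_vf (fun _ : M => 0).
Proof.
move=> q k; apply: (@Ck_ext _ _ _ _ _ (fun=> 0)); first exact: cimg_open.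
  by move=> x qx; rewrite vf_repE tmap0//; [exact: dom_self|exact: param_dom].
exact: Ck_cst.
Qed.

Lemma smooth_vf_comb (I : Type) (s : seq I) (f : I -> M -> R) (X : I -> vfield M) :
  (forall i, smooth_fun (f i)) -> (forall i, smooth_vf (X i)) ->
  smooth_vf (fun y => \sum_(i <- s) f i y *: X i y).
Proof.
move=> sf sX; elim: s => [|i s IH].
  rewrite (_ : (fun _ => _) = fun=> 0); first exact: smooth_vf0.
  by apply/funext => y; rewrite big_nil.
rewrite (_ : (fun _ => _) = vf_add (vf_scale (f i) (X i))
  (fun y => \sum_(i <- s) f i y *: X i y)); last first.
  by apply/funext => y; rewrite big_cons.
by apply: smooth_vf_add => //; exact: smooth_vf_scale.
Qed.

(** The cut-off coordinate fields are the basis vectors at [p], so a combination with constant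
    coefficients works. *)
Lemma vfield_through p (v : 'rV[R]_n) : exists2 X, smooth_vf X & X p = v.
Proof.
have pp := dom_self p.
have [K [F [sK sF F1]]] := cutoff_exists pp.
have sFp : smooth_on (cim p) F by exact: smooth_on_sub sF.
exists (fun y => \sum_(i < n) v ord0 i *: ext_field p F i y).
  apply: (@smooth_vf_comb _ _ (fun i _ => v ord0 i)) => i.
    exact: smooth_fun_cst.
  exact: smooth_ext_field sK sFp.
rewrite [RHS]row_sum_delta; apply: eq_bigr => i _; rewrite /ext_field.
by case: asboolP => // _; rewrite F1 scale1r tmap_id.
Qed.

(** [F^2 U] is a global combination of the cut-off coordinate fields with smooth coefficients, and
    [F = 1] at [p], so [T U] depends only on the components of [U p]. The rows of the matrix are the
    values of [T] on these fields. *)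
Lemma tensorial_linear (p : M) (T : vfield M -> 'rV[R]_n) :
  (forall U V, smooth_vf U -> smooth_vf V -> T (vf_add U V) = T U + T V) ->
  (forall f U, smooth_fun f -> smooth_vf U -> T (vf_scale f U) = f p *: T U) ->
  exists A : 'M[R]_n, forall U, smooth_vf U -> T U = U p *m A.
Proof.
move=> TD TZ; have pp := dom_self p.
have [K [F [sK sF F1]]] := cutoff_exists pp.
have sFp : smooth_on (cim p) F by exact: smooth_on_sub sF.
have sX i : smooth_vf (ext_field p F i) by exact: smooth_ext_field sK sFp.
exists (\matrix_(i < n) T (ext_field p F i)) => U sU.
have Tcomb (s : seq 'I_n) (f : 'I_n -> M -> R) : (forall i, smooth_fun (f i)) ->
    T (fun y => \sum_(i <- s) f i y *: ext_field p F i y) =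
    \sum_(i <- s) f i p *: T (ext_field p F i).
  move=> sf; elim: s => [|i s IH].
    rewrite big_nil (_ : (fun _ => _) = vf_scale (fun=> 0) (fun=> 0)).
      rewrite TZ ?scale0r//; [exact: smooth_fun_cst|exact: smooth_vf0].
    by apply/funext => y; rewrite big_nil /vf_scale scale0r.
  rewrite big_cons -IH -TZ//.
  rewrite -TD; [|exact: smooth_vf_scale|exact: smooth_vf_comb].
  by congr T; apply/funext => y; rewrite big_cons.
have sf i : smooth_fun (ext_fun p (fun x => F x * vf_rep U p x ord0 i)).
  apply: smooth_ext_fun (supported_inM _ sK) _ => k.
  apply: Ck_mul; [exact: cimg_open|exact: sFp|].
  by apply: Ck_coord; [exact: cimg_open|exact: sU].
have sF2 : smooth_fun (fun y => ext_fun p F y * ext_fun p F y).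
  by apply: smooth_fun_mul; exact: smooth_ext_fun sK sFp.
have eF : ext_fun p F p = 1 by rewrite /ext_fun; case: asboolP.
have := Tcomb (index_enum _) _ sf.
rewrite (_ : (fun _ => _) =
    vf_scale (fun y => ext_fun p F y * ext_fun p F y) U); last first.
  by apply/funext => y; rewrite -ext_decomposition /vf_scale expr2.
rewrite TZ// eF mulr1 scale1r => ->.
rewrite mulmx_sum_row; apply: eq_bigr => i _.
rewrite rowK /ext_fun; case: asboolP => // _.
by rewrite F1 mul1r vf_rep_self.
Qed.

(** * Smoothness tested through the metric, and the gradient *)

Section Metric.
Variable g : riemannian_metric M.

(** A nonzero kernel vector would have length 0, against positivity. *)
Lemma metric_unit p : g p \in unitmx.
Proof.
rewrite -row_free_unit -kermx_eq0; apply/eqP/row_matrixP => i.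
rewrite row0; apply/eqP; apply: contraT => /(metric_pos g p).
by rewrite -row_mul mulmx_ker row0 mul0mx mxE ltxx.
Qed.

(* In the frame [ext_field q F], the components of [Z] are the products with the frame
   times the inverse Gram matrix. *)
Lemma smooth_vf_inner Z :
  (forall V, smooth_vf V -> smooth_fun (inner g Z V)) -> smooth_vf Z.
Proof.
move=> sZ q; apply: smooth_on_local => x0 qx0.
have [K [F [sK sF F1]]] := cutoff_exists (param_dom qx0).
rewrite paramK// in F1.
have sFq : smooth_on (cim q) F by exact: smooth_on_sub sF.
pose E i := ext_field q F i.
have sE i : smooth_vf (E i) by exact: smooth_ext_field sK sFq.
pose Em y : 'M[R]_n := \matrix_(i < n) E i y.
pose Gram y := Em y *m g y *m (Em y)^T.
pose B := cim q `&` [set x | F x != 0].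
have oB : open B.
  rewrite openE => x [qx /= Fx]; apply: filterI.
    by apply: open_nbhs_nbhs; split => //; exact: cimg_open.
  have cF : {for x, continuous F} by exact: (sF 0%N).
  have on0 : open [set t : R | t != 0].
    rewrite (_ : [set t | _] = ~` [set 0]).
      by apply: closed_openC; exact: closed_eq.
    by apply/seteqP; split=> t /= /eqP.
  by apply: (cF [set t | t != 0]); exact: open_nbhs_nbhs.
have uE x : B x -> Em (param q x) \in unitmx.
  move=> [qx /= Fx]; rewrite -row_full_unit -sub1mx.
  apply/row_subP => j; rewrite rowE mulmx1.
  (* The decomposition is a pointwise identity, so it applies to a field with constant components;
     dividing by [F^2] puts every basis vector in the row span of the frame. *)
  have := ext_decomposition q F (fun=> delta_mx ord0 j) (param q x).
  have -> : ext_fun q F (param q x) = F x.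
    rewrite /ext_fun; case: asboolP => [_|/(_ (param_dom qx))//].
    by rewrite paramK.
  move=> /(congr1 ( *:%R (F x ^- 2))).
  rewrite scalerA mulVf ?expf_neq0// scale1r => ->.
  apply: scalemx_sub; apply: summx_sub => i _; apply: scalemx_sub.
  by rewrite (_ : ext_field q F i _ = row i (Em (param q x))) ?row_sub// rowK.
have uG x : B x -> Gram (param q x) \in unitmx.
  by move=> Bx; rewrite !unitmx_mul unitmx_tr metric_unit uE.
have GramE i j y : Gram y i j = inner g (E i) (E j) y.
  rewrite /inner /Gram.
  have -> : E i y = row i (Em y) by rewrite rowK.
  have -> : E j y = row j (Em y) by rewrite rowK.
  by rewrite -row_mul !mxE; apply: eq_bigr => l _; rewrite !mxE.
exists B; split; first by split => //=; rewrite F1 oner_eq0.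
move=> k.
have BC (f : M -> R) : smooth_fun f -> Ck k B (f \o param q).
  by move=> sf; apply: Ck_sub (sf q k) => x [].
apply: (@Ck_ext _ _ _ _ _ (fun x => \sum_(i < n) (\sum_(j < n)
   inner g Z (E j) (param q x) * invmx (Gram (param q x)) j i) *:
   vf_rep (E i) q x)) => //.
  move=> x Bx; have [qx _] := Bx.
  have yy := dom_self (param q x); have qy := param_dom qx.
  rewrite !vf_repE; under eq_bigr => i _ do rewrite vf_repE -tmapZ//.
  rewrite -tmap_sum//; congr tmap.
  transitivity ((Z (param q x) *m g (param q x) *m (Em (param q x))^T) *m
     invmx (Gram (param q x)) *m Em (param q x)).
    rewrite mulmx_sum_row; apply: eq_bigr => i _; rewrite rowK; congr (_ *: _).
    rewrite mxE; apply: eq_bigr => j _; congr (_ * _).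
    rewrite /inner (_ : E j _ = row j (Em (param q x))); last by rewrite rowK.
    by rewrite tr_row !mxE; apply: eq_bigr => l _; rewrite !mxE.
  exact: frame_expansion (metric_unit _) (uE x Bx).
apply: Ck_sum => // i _; apply: Ck_scale => //; last first.
  by apply: Ck_sub (sE i q k) => x [].
apply: Ck_sum => // j _; apply: Ck_mul => //; first exact/BC/sZ.
apply: (@Ck_invmx _ _ _ _ oB _ (fun x => Gram (param q x))) => // i' j'.
apply: (@Ck_ext _ _ _ _ _ (inner g (E i') (E j') \o param q)) => //.
by apply: BC; exact: metric_smooth.
Qed.

Lemma inner_gradient (f : M -> R) V p : smooth_fun f ->
  inner g (gradient g f) V p = vf_app V f p.
Proof.
move=> sf; rewrite /inner /gradient mulmxKV ?metric_unit//.
rewrite /vf_app [RHS]derive_dir; last exact/(smooth_fun_diff sf)/dom_self.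
by rewrite mxE; apply: eq_bigr => i _; rewrite !mxE mulrC.
Qed.

(** The definition changes chart from point to point, so smoothness is read off the products
    [g(grad f, V) = V f]. *)
Lemma smooth_gradient (f : M -> R) : smooth_fun f -> smooth_vf (gradient g f).
Proof.
move=> sf; apply: smooth_vf_inner => V sV.
rewrite (_ : inner _ _ _ = vf_app V f); first exact: smooth_fun_app.
by apply/funext => p; exact: inner_gradient.
Qed.

End Metric.
End Extension.

(** * Functions with vanishing derivative on a connected manifold *)

Section Constancy.
Context (R : realType) (n : nat) (M : smooth_manifold R n).

Lemma vf_app0_constant (f : M -> R) : connected [set: M] -> smooth_fun f ->
  (forall U : vfield M, smooth_vf U -> forall p, vf_app U f p = 0) ->
  exists c, forall p, f p = c.
Proof.
move=> cM sf Uf.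
have locconst (p : M) : \forall y \near p, f y = f p.
  have pp := dom_self p.
  have /nbhs_normP[e /= e0 He] : nbhs (coord p p) (cimg (chart_at p)).
    by apply: open_nbhs_nbhs; split; [exact: cimg_open|exact: coord_cimg].
  (* Each coordinate direction is the value of some global smooth field, so the hypothesis on fields
     kills all directional derivatives in the chart. *)
  have D0 x u : cimg (chart_at p) x -> 'D_u (f \o param p) x = 0.
    move=> px; have py := param_dom px; have yy := dom_self (param p x).
    have [X sX Xy] := vfield_through (param p x) (tmap p (param p x) (param p x) u).
    have := vf_appE X sf py.
    rewrite (Uf _ sX) (paramK px).
    have -> : vf_rep X p x = u by rewrite vf_repE Xy tmapK.
    by move=> <-.
  have fc := @derive0_ball_const _ _ (f \o param p) (coord p p) e.
  have : \forall y \near p, `|coord p p - coord p y| < e.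
    have ne : \forall x \near coord p p, `|coord p p - x| < e by apply/nbhs_normP; exists e.
    exact: coord_continuous pp _ ne.
  have : \forall y \near p, cdom (chart_at p) y.
    by apply: open_nbhs_nbhs; split; [exact: cdom_open|].
  apply: filterS2 => y py ye.
  have := fc _ _ (coord p y) ye; rewrite /= !coordK//; apply.
  - by move=> x xe; apply: smooth_on_differentiable (sf p) (He _ xe).
  - by move=> x u xe; apply: D0; exact: He.
have [[p0 _]|/set0P/negP/negPn/eqP M0] := pselect ([set: M] !=set0); last first.
  by exists 0 => p; have : [set: M] p by []; rewrite M0.
exists (f p0) => p.
suff : [set y | f y = f p0] = [set: M] by move=> /seteqP[_ /(_ p)]; exact.
(* A level set of a locally constant function is open and closed. *)
apply: cM; first by exists p0.
- exists [set y | f y = f p0]; last by rewrite setTI.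
  rewrite openE => y /= fy; apply: filterS (locconst y) => z /= ->; exact: fy.
- exists [set y | f y = f p0]; last by rewrite setTI.
  rewrite -openC openE => y /= fy; apply: filterS (locconst y) => z /= zy fz.
  by apply: fy; rewrite -zy.
Qed.

End Constancy.

(** * Levi-Civita and semi-symmetric connections *)

Section Connection.
Context (R : realType) (n : nat) (M : smooth_manifold R n).
Context (g : riemannian_metric M).
Implicit Types (U V W X Y Z : vfield M) (f : M -> R).

Definition ip (p : M) (u v : 'rV[R]_n) : R := (u *m g p *m v^T) ord0 ord0.

Lemma innerE X Y p : inner g X Y p = ip p (X p) (Y p).
Proof. by []. Qed.

Lemma ipC p u v : ip p u v = ip p v u.
Proof.
transitivity ((u *m g p *m v^T)^T ord0 ord0); first by rewrite mxE.
by rewrite !trmx_mul trmxK metric_sym mulmxA.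
Qed.

Lemma ipDl p u v w : ip p (u + v) w = ip p u w + ip p v w.
Proof. by rewrite /ip !mulmxDl mxE. Qed.

Lemma ipZl p a u w : ip p (a *: u) w = a * ip p u w.
Proof. by rewrite /ip -!scalemxAl mxE. Qed.

Lemma ipNl p u w : ip p (- u) w = - ip p u w.
Proof. by rewrite -scaleN1r ipZl mulN1r. Qed.

Lemma ipBl p u v w : ip p (u - v) w = ip p u w - ip p v w.
Proof. by rewrite ipDl ipNl. Qed.

Lemma ip0l p w : ip p 0 w = 0.
Proof. by rewrite -(scale0r 0) ipZl mul0r. Qed.

Lemma ip0r p w : ip p w 0 = 0. Proof. by rewrite ipC ip0l. Qed.

Lemma ipDr p u v w : ip p w (u + v) = ip p w u + ip p w v.
Proof. by rewrite ipC ipDl ![ip p _ w]ipC. Qed.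

Lemma ipZr p a u w : ip p w (a *: u) = a * ip p w u.
Proof. by rewrite ipC ipZl ipC. Qed.

Lemma ipNr p u w : ip p w (- u) = - ip p w u.
Proof. by rewrite ipC ipNl ipC. Qed.

Lemma vf_app_cst U (c : R) p : vf_app U (fun=> c) p = 0.
Proof. exact: derive_cst. Qed.

Lemma vf_app_add U (f1 f2 : M -> R) p : smooth_fun f1 -> smooth_fun f2 ->
  vf_app U (fun q => f1 q + f2 q) p = vf_app U f1 p + vf_app U f2 p.
Proof.
move=> s1 s2; have pp := dom_self p; rewrite /vf_app.
by rewrite -deriveD //; apply: diff_derivable; exact: smooth_fun_diff.
Qed.

Lemma vf_app_mul U (f1 f2 : M -> R) p : smooth_fun f1 -> smooth_fun f2 ->
  vf_app U (fun q => f1 q * f2 q) p = vf_app U f1 p * f2 p + f1 p * vf_app U f2 p.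
Proof.
move=> s1 s2; have pp := dom_self p; rewrite /vf_app.
have := @deriveM _ _ (f1 \o param p) (f2 \o param p) (coord p p) (U p).
rewrite /= coordK// addrC [f2 p *: _]mulrC; apply; apply: diff_derivable; exact: smooth_fun_diff.
Qed.

(* Comparing two smoothness hypotheses by unfolding them is very slow. *)
Local Opaque smooth_vf smooth_fun vf_app lie_bracket gradient vf_rep.

Context (D : vfield M -> vfield M -> vfield M).
Context (lcD : is_levi_civita g D).

Let cD : is_connection D := lc_connection lcD.

Lemma conn_0r U : smooth_vf U -> D U (fun=> 0) = fun=> 0.
Proof.
move=> sU; apply/funext => p; apply: (addIr (D U (fun=> 0) p)).
have s0 := @smooth_vf0 _ _ M.
have := congr1 (@^~ p) (conn_addr cD sU s0 s0).
rewrite /= (_ : vf_add _ _ = fun=> 0); first by rewrite /vf_add add0r => <-.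
by apply/funext => q; rewrite /vf_add addr0.
Qed.

Lemma smooth_conn U V : smooth_vf U -> smooth_vf V -> smooth_vf (D U V).
Proof. exact: (conn_smooth cD). Qed.

Lemma smooth_inner X Y : smooth_vf X -> smooth_vf Y -> smooth_fun (inner g X Y).
Proof. exact: metric_smooth. Qed.

(** Torsion-freeness writes the bracket as a difference of covariant derivatives, which are smooth
    by the axioms. *)
Lemma smooth_bracket U V : smooth_vf U -> smooth_vf V -> smooth_vf (lie_bracket U V).
Proof.
move=> sU sV; rewrite -(lc_torsion_free lcD sU sV).
by apply: smooth_vf_sub; exact: smooth_conn.
Qed.

Ltac smooth := repeat lazymatch goal with
  | |- smooth_vf (vf_add _ _) => apply: smooth_vf_add
  | |- smooth_vf (vf_sub _ _) => apply: smooth_vf_sub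
  | |- smooth_vf (vf_scale _ _) => apply: smooth_vf_scale
  | |- smooth_vf (lie_bracket _ _) => apply: smooth_bracket
  | |- smooth_vf (gradient _ _) => apply: smooth_gradient
  | |- smooth_vf (D _ _) => apply: smooth_conn
  | |- smooth_fun (vf_app _ _) => apply: smooth_fun_app
  | |- smooth_fun (inner _ _ _) => apply: smooth_inner
  | |- smooth_fun (fun q => inner _ _ _ q + inner _ _ _ q) => apply: smooth_fun_add
  | |- smooth_fun (fun _ => -1) => exact: smooth_fun_cst
  | |- _ => assumption
  end.

Lemma conn_subl U V W p : smooth_vf U -> smooth_vf V -> smooth_vf W ->
  D (vf_sub U V) W p = D U W p - D V W p.
Proof.
move=> sU sV sW.
rewrite vf_subE (conn_addl cD); [|smooth..].
rewrite (conn_scalel cD); [|smooth..].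
by rewrite /vf_add /vf_scale scaleN1r.
Qed.

Lemma bracketE U V p : smooth_vf U -> smooth_vf V ->
  lie_bracket U V p = D U V p - D V U p.
Proof. by move=> sU sV; rewrite -(lc_torsion_free lcD sU sV). Qed.

Lemma conn_bracket U V Y p : smooth_vf U -> smooth_vf V -> smooth_vf Y ->
  D (lie_bracket U V) Y p = D (D U V) Y p - D (D V U) Y p.
Proof.
move=> sU sV sY; rewrite -(lc_torsion_free lcD sU sV).
by apply: conn_subl; smooth.
Qed.

(** With the bracket gone, the rules for the curvature follow from the connection axioms alone. *)
Lemma curvatureE U V Y p : smooth_vf U -> smooth_vf V -> smooth_vf Y ->
  curvature D U V Y p = D U (D V Y) p - D V (D U Y) p -
    (D (D U V) Y p - D (D V U) Y p).
Proof. by move=> sU sV sY; rewrite -conn_bracket. Qed.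

Lemma curvature_skew U V Y p : smooth_vf U -> smooth_vf V -> smooth_vf Y ->
  curvature D U V Y p = - curvature D V U Y p.
Proof.
move=> sU sV sY; rewrite !curvatureE; [|smooth..].
by apply/rowP => i; rewrite !mxE; ring.
Qed.

Lemma curvature_addl U V W Y p :
  smooth_vf U -> smooth_vf V -> smooth_vf W -> smooth_vf Y ->
  curvature D (vf_add U V) W Y p = curvature D U W Y p + curvature D V W Y p.
Proof.
move=> sU sV sW sY; rewrite !curvatureE; [|smooth..].
rewrite !(conn_addl cD); [|smooth..].
rewrite !(conn_addr cD); [|smooth..].
rewrite !(conn_addl cD); [|smooth..].
by apply/rowP => i; rewrite /vf_add !mxE; ring.
Qed.

(** The terms [(W f) D_U Y] coming from [D_W (f D_U Y)] and from [D_W (f U)] cancel. *)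
Lemma curvature_scalel f U W Y p :
  smooth_fun f -> smooth_vf U -> smooth_vf W -> smooth_vf Y ->
  curvature D (vf_scale f U) W Y p = f p *: curvature D U W Y p.
Proof.
move=> sf sU sW sY; rewrite !curvatureE; [|smooth..].
rewrite !(conn_scalel cD); [|smooth..].
rewrite !(conn_leibniz cD); [|smooth..].
rewrite !(conn_addl cD); [|smooth..].
rewrite !(conn_scalel cD); [|smooth..].
by apply/rowP => i; rewrite /vf_add /vf_scale !mxE; ring.
Qed.

Lemma vf_app_inner U Y Z : smooth_vf U -> smooth_vf Y -> smooth_vf Z ->
  vf_app U (inner g Y Z) = fun p => inner g (D U Y) Z p + inner g Y (D U Z) p.
Proof. by move=> sU sY sZ; apply/funext => p; apply: (lc_metric lcD). Qed.

(** This is the identity [[U, V] = U V - V U] applied to the function [g(Y, Z)] and expanded by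
    metric compatibility. *)
Lemma curvature_inner_skew U V Y Z p :
  smooth_vf U -> smooth_vf V -> smooth_vf Y -> smooth_vf Z ->
  ip p (curvature D U V Y p) (Z p) = - ip p (curvature D U V Z p) (Y p).
Proof.
move=> sU sV sY sZ.
have sB := smooth_bracket sU sV.
have := lie_bracket_app p sU sV (smooth_inner sY sZ).
rewrite !vf_app_inner; [|smooth..].
rewrite !vf_app_add; [|smooth..].
rewrite !vf_app_inner; [|smooth..].
rewrite !innerE /curvature /vf_sub !ipDl !ipNl.
rewrite ![ip p (Y p) _]ipC [ip p (D U Y p) (D V Z p)]ipC [ip p (D V Y p) (D U Z p)]ipC.
by lra.
Qed.

(** The same identity applied to [f], combined with torsion-freeness, leaves exactly the two Hessian
    terms. *)
Lemma hessian_sym f U V p : smooth_fun f -> smooth_vf U -> smooth_vf V ->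
  ip p (D U (gradient g f) p) (V p) = ip p (D V (gradient g f) p) (U p).
Proof.
move=> sf sU sV.
have iG X : vf_app X f = inner g (gradient g f) X.
  by apply/funext => q; rewrite inner_gradient.
have := lie_bracket_app p sU sV sf.
rewrite !iG !vf_app_inner; [|smooth..].
rewrite !innerE bracketE; [|smooth..].
by rewrite ipDr ipNr; lra.
Qed.

(** * Curvature of the semi-symmetric connection of a parallel field *)

Context (xi : vfield M).
Context (sxi : smooth_vf xi).
Context (xi_par : forall U, smooth_vf U -> D U xi = fun=> 0).

Lemma curvature_xi U V p : smooth_vf U -> smooth_vf V ->
  curvature D U V xi p = 0.
Proof.
move=> sU sV; have sB := smooth_bracket sU sV; rewrite /curvature /vf_sub.
by rewrite (xi_par sU) (xi_par sV) (xi_par sB) (conn_0r sU) (conn_0r sV) !subr0.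
Qed.

Lemma vf_app_psi U Y : smooth_vf U -> smooth_vf Y ->
  vf_app U (inner g Y xi) = inner g (D U Y) xi.
Proof.
move=> sU sY; rewrite vf_app_inner; [|smooth..]; apply/funext => p.
by rewrite (xi_par sU) !innerE ip0r addr0.
Qed.

Local Notation Dh := (semi_symmetric_conn g D xi).

(** In [second] the terms with [psi(D_X Y) Z] and [psi(D_Z Y) X] are symmetric in [X] and [Z] and
    cancel; [psi(Y) D_X Z] antisymmetrises to [psi(Y) [X, Z]], which the bracket term removes; the
    product [psi(Y) psi(Z) X] survives. *)
Lemma curvature_semi_symmetric U V Y p :
  smooth_vf U -> smooth_vf V -> smooth_vf Y ->
  curvature Dh U V Y p = curvature D U V Y p +
    ip p (Y p) (xi p) *: (ip p (V p) (xi p) *: U p - ip p (U p) (xi p) *: V p).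
Proof.
move=> sU sV sY.
have second X Z : smooth_vf X -> smooth_vf Z ->
  Dh X (Dh Z Y) p =
  D X (D Z Y) p + ip p (D X Y p) (xi p) *: Z p + ip p (Y p) (xi p) *: D X Z p +
    (ip p (D Z Y p) (xi p) + ip p (Y p) (xi p) * ip p (Z p) (xi p)) *: X p.
  move=> sX sZ; rewrite /semi_symmetric_conn.
  rewrite (conn_addr cD); [|smooth..].
  rewrite (conn_leibniz cD); [|smooth..].
  rewrite vf_app_psi; [|smooth..].
  by rewrite /vf_add /vf_scale !innerE ipDl ipZl !addrA.
rewrite [LHS]/curvature /vf_sub !second; [|smooth..].
rewrite curvatureE; [|smooth..].
rewrite /semi_symmetric_conn {1}/vf_add {1}/vf_scale.
rewrite conn_bracket; [|smooth..].
rewrite bracketE; [|smooth..].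
by apply/rowP => i; rewrite !mxE innerE; ring.
Qed.

(** This ensures that [ricci] is the trace of a matrix representing the curvature and not of the
    default of [endo_mx]. *)
Lemma curvature_semi_symmetric_tensorial V Y p : smooth_vf V -> smooth_vf Y ->
  exists A : 'M[R]_n, forall U, smooth_vf U -> curvature Dh U V Y p = U p *m A.
Proof.
move=> sV sY.
apply: (@tensorial_linear _ _ _ _ (fun U => curvature Dh U V Y p)) => [U W sU sW|f U sf sU].
  cbv beta; rewrite !curvature_semi_symmetric; [|smooth..].
  rewrite curvature_addl; [|smooth..].
  rewrite /vf_add ipDl.
  move: (curvature D U V Y p) (curvature D W V Y p) => a b.
  move: (ip p (Y p) _) (ip p (V p) _) (ip p (U p) _) (ip p (W p) _) => c d e f.
  by apply/rowP => i; rewrite !mxE; ring.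
rewrite !curvature_semi_symmetric; [|smooth..].
rewrite curvature_scalel; [|smooth..].
rewrite /vf_scale ipZl.
move: (curvature D U V Y p) (ip p (Y p) _) (ip p (V p) _) (ip p (U p) _) => a b c d.
by apply/rowP => i; rewrite !mxE; ring.
Qed.

End Connection.

(** Orthonormality of the rows of [E] gives [G E^T E = 1], which is inserted under the trace before
    a cyclic permutation. *)
Lemma trace_orthonormal (R : realType) n (G E A : 'M[R]_n) : E *m G *m E^T = 1%:M ->
  \tr A = \sum_i (row i E *m A *m G *m (row i E)^T) ord0 ord0.
Proof.
rewrite -mulmxA => /mulmx1C EG.
transitivity (\tr (A *m (G *m E^T *m E))); first by rewrite EG mulmx1.
rewrite !mulmxA mxtrace_mulC /mxtrace; apply: eq_bigr => i _.
by rewrite !mulmxA -!row_mul !mxE; apply: eq_bigr => j _; rewrite !mxE.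
Qed.

Lemma trace_invmx_orthonormal (R : realType) n (G E B : 'M[R]_n) : E *m G *m E^T = 1%:M ->
  \tr (invmx G *m B) = \sum_i (row i E *m B *m (row i E)^T) ord0 ord0.
Proof.
move=> EG.
have GE : G *m (E^T *m E) = 1%:M by rewrite mulmxA; apply: mulmx1C; rewrite mulmxA.
have [uG _] := mulmx1_unit GE.
have -> : invmx G = E^T *m E by rewrite -[RHS](mulKmx uG) GE mulmx1.
rewrite -mulmxA mxtrace_mulC /mxtrace; apply: eq_bigr => i _.
by rewrite -!row_mul !mxE; apply: eq_bigr => j _; rewrite !mxE.
Qed.

(** * Orthonormal frames in dimension 3 *)

(** When the columns of [C] are [G e^T], this finds a nonzero vector orthogonal to fewer than [n]
    given ones. *)
Lemma left_kernel_exists (F : fieldType) m n (C : 'M[F]_(n, m)) : (m < n)%N ->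
  exists2 v : 'rV[F]_n, v != 0 & v *m C = 0.
Proof.
move=> mn.
have : kermx C != 0.
  by rewrite -mxrank_eq0 mxrank_ker subn_eq0 -ltnNge (leq_ltn_trans (rank_leq_col C)).
move=> /rowV0Pn[v vK v0]; exists v => //; exact/sub_kermxP.
Qed.

Section Tensors.
Context (R : realType) (n : nat) (M : smooth_manifold R n) (p : M).

(** Once a representing matrix exists, [xget] returns such a matrix instead of its default 0. *)
Lemma endo_mxP (T : vfield M -> vfield M) :
  (exists A, forall U, smooth_vf U -> T U p = U p *m A) ->
  forall U, smooth_vf U -> T U p = U p *m endo_mx T p.
Proof. exact: xgetPex. Qed.

Lemma form_mxP (B : vfield M -> vfield M -> M -> R) :
  (exists A, forall U V, smooth_vf U -> smooth_vf V ->
     B U V p = (U p *m A *m (V p)^T) ord0 ord0) ->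
  forall U V, smooth_vf U -> smooth_vf V ->
    B U V p = (U p *m form_mx B p *m (V p)^T) ord0 ord0.
Proof. exact: xgetPex. Qed.

End Tensors.

Section Frame3.
Context (R : realType) (M : smooth_manifold R 3) (g : riemannian_metric M) (p : M).
Local Notation dot := (ip g p).

Lemma ip_normalize v : v != 0 -> exists2 t : R, t != 0 & dot (t *: v) (t *: v) = 1.
Proof.
move=> /(metric_pos g p); rewrite -/(dot v v) => v0.
exists (Num.sqrt (dot v v))^-1; first by rewrite invr_eq0 sqrtr_eq0 -ltNge.
by rewrite ipZl ipZr mulrA -expr2 exprVn sqr_sqrtr ?mulVf ?gt_eqF// ltW.
Qed.

Definition orthonormal3 (e0 e1 e2 : 'rV[R]_3) : Prop :=
  [/\ dot e0 e0 = 1, dot e1 e1 = 1, dot e2 e2 = 1 &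
   [/\ dot e0 e1 = 0, dot e0 e2 = 0 & dot e1 e2 = 0]].

Lemma orthonormal3_exists e0 : dot e0 e0 = 1 -> exists e1 e2, orthonormal3 e0 e1 e2.
Proof.
move=> e00.
have [v v0 vK] := @left_kernel_exists _ _ _ (g p *m e0^T) isT.
have [t t0 te] := ip_normalize v0.
have e01 : dot e0 (t *: v) = 0.
  by rewrite ipZr ipC /ip -mulmxA vK mxE mulr0.
have [w w0 wK] := @left_kernel_exists _ _ _
  (row_mx (g p *m e0^T) (g p *m (t *: v)^T)) isT.
have [s s0 se] := ip_normalize w0.
move: wK; rewrite mul_mx_row -[0]row_mx0 => /eq_row_mx[w0K w1K].
exists (t *: v), (s *: w); split => //; split => //.
  by rewrite ipZr ipC /ip -mulmxA w0K mxE mulr0.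
by rewrite ipZr ipC /ip -mulmxA w1K mxE mulr0.
Qed.

Context (e0 e1 e2 : 'rV[R]_3) (e : orthonormal3 e0 e1 e2).

Let E : 'M[R]_3 := \matrix_(i < 3) nth 0 [:: e0; e1; e2] i.

Let E_ortho : E *m g p *m E^T = 1%:M.
Proof.
have [e00 e11 e22 [e01 e02 e12]] := e.
apply/matrixP => i j.
have -> : (E *m g p *m E^T) i j = dot (row i E) (row j E).
  by rewrite /ip -row_mul !mxE; apply: eq_bigr => l _; rewrite !mxE.
rewrite !rowK !mxE.
case: i => -[|[|[|//]]] /= hi; case: j => -[|[|[|//]]] /= hj;
  by rewrite // [dot _ _]ipC.
Qed.

Lemma sum_frame3 (V : zmodType) (F : 'rV[R]_3 -> V) :
  \sum_(i < 3) F (row i E) = F e0 + F e1 + F e2.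
Proof.
by rewrite !big_ord_recl big_ord0 addr0 !rowK /= addrA.
Qed.

Lemma mxtrace3 (A : 'M[R]_3) :
  \tr A = dot (e0 *m A) e0 + dot (e1 *m A) e1 + dot (e2 *m A) e2.
Proof. by rewrite (trace_orthonormal A E_ortho) (sum_frame3 (fun u => dot (u *m A) u)). Qed.

Lemma metric_trace3 (B : 'M[R]_3) : \tr (invmx (g p) *m B) =
  (e0 *m B *m e0^T) ord0 ord0 + (e1 *m B *m e1^T) ord0 ord0 +
  (e2 *m B *m e2^T) ord0 ord0.
Proof.
rewrite (trace_invmx_orthonormal B E_ortho).
exact: (sum_frame3 (fun u => (u *m B *m u^T) ord0 ord0)).
Qed.

Lemma expand3 v : v = dot v e0 *: e0 + dot v e1 *: e1 + dot v e2 *: e2.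
Proof.
rewrite -(sum_frame3 (fun u => dot v u *: u)).
have GE : g p *m E^T *m E = 1%:M by apply: mulmx1C; rewrite mulmxA E_ortho.
rewrite -[LHS]mulmx1 -GE !mulmxA mulmx_sum_row; apply: eq_bigr => i _.
by congr (_ *: _); rewrite /ip !mxE; apply: eq_bigr => l _; rewrite !mxE.
Qed.

End Frame3.

(** * Gradient Einstein solitons *)

Section Soliton.
Context (R : realType) (M : smooth_manifold R 3) (g : riemannian_metric M).
Context (D : vfield M -> vfield M -> vfield M) (lcD : is_levi_civita g D).
Context (xi : vfield M) (sxi : smooth_vf xi).
Context (xi_unit : forall p : M, inner g xi xi p = 1).
Context (xi_par : forall U, smooth_vf U -> D U xi = fun=> 0).
Context (f : M -> R) (lambda : R) (sf : smooth_fun f).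

Local Notation Dh := (semi_symmetric_conn g D xi).
Local Notation scal := (scalar_curvature g Dh).
Local Notation grad := (gradient g f).
Local Notation phi := (inner g grad xi).

Context (soliton : forall U V, smooth_vf U -> smooth_vf V -> forall p,
  ricci Dh U V p - 2^-1 * scal p * inner g U V p
  + hessian g Dh f U V p + lambda * inner g U V p = 0).

Let curvature_unfold U V Y p :
  curvature D U V Y p = D U (D V Y) p - D V (D U Y) p - D (lie_bracket U V) Y p.
Proof. by []. Qed.

Local Opaque smooth_vf smooth_fun vf_app lie_bracket gradient vf_rep curvature.

Let sgrad : smooth_vf grad. Proof. exact: smooth_gradient. Qed.

(** The term [- phi] is the difference between the two connections applied to the gradient. The
    right-hand side is visibly tensorial, and symmetric by [hessian_sym]. *)
Lemma ricci_solitonE U V p : smooth_vf U -> smooth_vf V ->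
  ricci Dh U V p =
  ip g p ((2^-1 * scal p - phi p - lambda) *: U p - D U grad p) (V p).
Proof.
move=> sU sV; have := soliton sU sV p.
rewrite /hessian /semi_symmetric_conn !innerE /vf_add /vf_scale ipDl ipBl !ipZl.
rewrite -/(semi_symmetric_conn g D xi) innerE.
by move=> E; apply/eqP; rewrite -subr_eq0 -E; apply/eqP; ring.
Qed.

Lemma conn_grad_tensorial p : exists A : 'M[R]_3, forall U, smooth_vf U ->
  D U grad p = U p *m A.
Proof.
have cD := lc_connection lcD.
apply: (@tensorial_linear _ _ _ _ (fun U => D U grad p)) => [U V sU sV|h U sh sU].
  by rewrite (conn_addl cD sU sV sgrad).
by rewrite (conn_scalel cD sh sU sgrad).
Qed.

(** The soliton equation itself supplies the matrix of the Ricci form, so [form_mx] is not the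
    default and its metric trace is the sum over the frame. *)
Lemma scal_frame3 p (E0 E1 E2 : vfield M) :
  smooth_vf E0 -> smooth_vf E1 -> smooth_vf E2 ->
  orthonormal3 g p (E0 p) (E1 p) (E2 p) ->
  scal p = ricci Dh E0 E0 p + ricci Dh E1 E1 p + ricci Dh E2 E2 p.
Proof.
move=> s0 s1 s2 oE.
have [A HA] := conn_grad_tensorial p.
have H : exists B : 'M[R]_3, forall U V, smooth_vf U -> smooth_vf V ->
    ricci Dh U V p = (U p *m B *m (V p)^T) ord0 ord0.
  exists (((2^-1 * scal p - phi p - lambda)%:M - A) *m g p) => U V sU sV.
  by rewrite ricci_solitonE// HA// /ip mulmxA mulmxBr mul_mx_scalar.
rewrite {1}/scalar_curvature /metric_trace (metric_trace3 oE).
by rewrite !(form_mxP H).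
Qed.

Local Opaque ip inner.

(** The trace of [U |-> psi(Y) (psi(V) U - psi(U) V)] is [(3 - 1) psi(V) psi(Y)], whence the factor
    2. *)
Lemma ricci_frame3 p (E1 E2 V Y : vfield M) :
  smooth_vf E1 -> smooth_vf E2 -> smooth_vf V -> smooth_vf Y ->
  orthonormal3 g p (xi p) (E1 p) (E2 p) ->
  ricci Dh V Y p =
    ip g p (curvature D xi V Y p) (xi p) + ip g p (curvature D E1 V Y p) (E1 p) +
    ip g p (curvature D E2 V Y p) (E2 p) +
    2 * (ip g p (V p) (xi p) * ip g p (Y p) (xi p)).
Proof.
move=> s1 s2 sV sY oE.
have HA := @endo_mxP _ _ _ p (fun U => curvature Dh U V Y) (curvature_semi_symmetric_tensorial lcD sxi xi_par p sV sY).
rewrite {1}/ricci (mxtrace3 oE) -(HA _ sxi) -(HA _ s1) -(HA _ s2).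
have term X : smooth_vf X -> ip g p (curvature Dh X V Y p) (X p) =
    ip g p (curvature D X V Y p) (X p) + ip g p (Y p) (xi p) *
    (ip g p (V p) (xi p) * ip g p (X p) (X p) -
     ip g p (X p) (xi p) * ip g p (V p) (X p)).
  move=> sX; rewrite (curvature_semi_symmetric lcD sxi xi_par p sX sV sY).
  by rewrite [LHS]ipDl ipZl; congr (_ + _ * _); rewrite ipBl !ipZl.
apply: (etrans (f_equal2 +%R (f_equal2 +%R (term _ sxi) (term _ s1)) (term _ s2))).
have [e00 e11 e22 [e01 e02 e12]] := oE.
rewrite e00 e11 e22 [ip g p (E1 p) (xi p)]ipC e01 [ip g p (E2 p) (xi p)]ipC e02.
ring.
Qed.

(* What the soliton equation says at a point, in an orthonormal frame starting with [xi];
   [H] below is the second derivative of [f] along [xi]. *)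
Lemma soliton_pointwise p : exists E1,
  [/\ smooth_vf E1, ip g p (E1 p) (E1 p) = 1, ip g p (E1 p) (xi p) = 0,
      curvature D xi E1 E1 p = 0 &
      let H := ip g p (D xi grad p) (xi p) in let b := 1 - lambda - phi p in
      scal p = 2 * (2 + lambda + phi p + H) /\
      forall U, smooth_vf U ->
        D U grad p = b *: U p + ((H - b) * ip g p (U p) (xi p)) *: xi p].
Proof.
have := xi_unit p; rewrite innerE => /orthonormal3_exists[v1 [v2 o12]].
have [E1 s1 E1p] := vfield_through p v1.
have [E2 s2 E2p] := vfield_through p v2.
rewrite -E1p -E2p in o12.
have [e00 e11 e22 [e01 e02 e12]] := o12.
have e10 : ip g p (E1 p) (xi p) = 0 by rewrite ipC.
have e20 : ip g p (E2 p) (xi p) = 0 by rewrite ipC.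
have e21 : ip g p (E2 p) (E1 p) = 0 by rewrite ipC.
(* The curvature as a 4-tensor. The facts below give its skewness in each pair and its vanishing
   when [xi] is in the third or fourth slot. *)
pose c U V Y Z := ip g p (curvature D U V Y p) (Z p).
have c12 U V Y Z : smooth_vf U -> smooth_vf V -> smooth_vf Y ->
    c U V Y Z = - c V U Y Z.
  by move=> sU sV sY; rewrite /c (curvature_skew lcD p sU sV sY) ipNl.
have c34 U V Y Z : smooth_vf U -> smooth_vf V -> smooth_vf Y -> smooth_vf Z ->
    c U V Y Z = - c U V Z Y.
  by move=> sU sV sY sZ; exact: curvature_inner_skew.
have c_xi3 U V Z : smooth_vf U -> smooth_vf V -> c U V xi Z = 0.
  by move=> sU sV; rewrite /c (curvature_xi lcD xi_par p sU sV) ip0l.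
have c_xi4 U V Z : smooth_vf U -> smooth_vf V -> smooth_vf Z -> c U V Z xi = 0.
  by move=> sU sV sZ; rewrite c34// c_xi3// oppr0.
have c_diag12 U Y Z : smooth_vf U -> smooth_vf Y -> c U U Y Z = 0.
  by move=> sU sY; have := c12 U U Y Z sU sU sY; lra.
have c_diag34 U V Z : smooth_vf U -> smooth_vf V -> smooth_vf Z -> c U V Z Z = 0.
  by move=> sU sV sZ; have := c34 U V Z Z sU sV sZ sZ; lra.
have ric V Y : smooth_vf V -> smooth_vf Y -> ricci Dh V Y p =
    c xi V Y xi + c E1 V Y E1 + c E2 V Y E2 +
    2 * (ip g p (V p) (xi p) * ip g p (Y p) (xi p)).
  by move=> sV sY; exact: ricci_frame3.
have ricC V Y : smooth_vf V -> smooth_vf Y -> ricci Dh V Y p = ricci Dh Y V p.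
  move=> sV sY; rewrite !ricci_solitonE// !ipBl !ipZl (ipC g p (V p)).
  by rewrite (hessian_sym lcD p sf sV sY).
(* The remaining component [c E2 E1 E1 E2] is the sectional curvature [K] of the plane orthogonal to
   [xi]. *)
have r11 : ricci Dh E1 E1 p = c E2 E1 E1 E2.
  by rewrite ric// c_xi4// c_diag12// e10; ring.
have r22 : ricci Dh E2 E2 p = c E2 E1 E1 E2.
  rewrite ric// c_xi4// (c_diag12 E2)// e20 (c12 E1 E2)// (c34 E2 E1 E2)//; ring.
have r00 : ricci Dh xi xi p = 2 by rewrite ric// !c_xi3// e00; ring.
have r10 : ricci Dh E1 xi p = 0 by rewrite ric// !c_xi3// e10; ring.
have r20 : ricci Dh E2 xi p = 0 by rewrite ric// !c_xi3// e20; ring.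
have r12 : ricci Dh E1 E2 p = 0.
  by rewrite ric// c_xi4// c_diag12// c_diag34// e10; ring.
have r02 : ricci Dh xi E2 p = c E1 xi E2 E1.
  by rewrite ric// c_diag12// c_diag34// e20; ring.
have r01 : ricci Dh xi E1 p = 0 by rewrite ricC.
(* Symmetry equates this mixed component, the Ricci value at [(xi, E2)], with the value at
   [(E2, xi)], which is 0 because [xi] is then in the third slot. *)
have c1021 : c E1 xi E2 E1 = 0 by rewrite -r02 ricC.
have Escal : scal p = 2 + 2 * c E2 E1 E1 E2.
  by rewrite (scal_frame3 sxi s1 s2 o12) r00 r11 r22; ring.
have hess U V : smooth_vf U -> smooth_vf V -> ip g p (D U grad p) (V p) =
    (2^-1 * scal p - phi p - lambda) * ip g p (U p) (V p) - ricci Dh U V p.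
  by move=> sU sV; rewrite ricci_solitonE// ipBl ipZl; ring.
exists E1; split => //.
  rewrite (expand3 o12 (curvature D xi E1 E1 p)).
  rewrite -/(c xi E1 E1 xi) -/(c xi E1 E1 E1) -/(c xi E1 E1 E2).
  rewrite c_xi4// c_diag34// (c12 xi E1)// (c34 E1 xi E1)// c1021.
  by rewrite !oppr0 !scale0r !addr0.
(* The soliton equation at [(xi, xi)] reads [H = (K + 1) - phi - lambda - 2], which expresses [K]
   through [H]. *)
move=> H b.
have EH : c E2 E1 E1 E2 = H + 1 + phi p + lambda.
  by rewrite /H hess// e00 r00 Escal; field.
split; first by rewrite Escal EH; ring.
move=> U sU; have [A HA] := conn_grad_tensorial p.
(* In the frame, the endomorphism [U |-> D U grad] is diagonal with entries [H], [b], [b]; the value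
   of [b] uses that half the scalar curvature minus [K] is 1. *)
have hE V a0 a1 a2 : smooth_vf V -> ip g p (D V grad p) (xi p) = a0 ->
    ip g p (D V grad p) (E1 p) = a1 -> ip g p (D V grad p) (E2 p) = a2 ->
    V p *m A = a0 *: xi p + a1 *: E1 p + a2 *: E2 p.
  by move=> sV <- <- <-; rewrite -HA//; exact: expand3.
have A0 : xi p *m A = H *: xi p + 0 *: E1 p + 0 *: E2 p.
  by apply: hE => //; rewrite hess// ?e01 ?e02 ?r01 ?(ricC xi E2)// ?r20; ring.
have A1 : E1 p *m A = 0 *: xi p + b *: E1 p + 0 *: E2 p.
  apply: hE => //; rewrite hess// ?e10 ?e11 ?e12 ?r10 ?r11 ?r12; first by ring.
    by rewrite Escal /b; field.
  by ring.
have A2 : E2 p *m A = 0 *: xi p + 0 *: E1 p + b *: E2 p.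
  apply: hE => //; rewrite hess// ?e20 ?e21 ?e22 ?r20 ?(ricC E2 E1)// ?r12 ?r22.
  - by ring.
  - by ring.
  - by rewrite Escal /b; field.
rewrite (HA _ sU); move: (expand3 o12 (U p)).
move: (ip g p (U p) _) (ip g p (U p) _) (ip g p (U p) _) => u0 u1 u2 ->.
rewrite !mulmxDl -!scalemxAl A0 A1 A2; move: H b {A0 A1 A2 hE EH} => H b.
by apply/rowP => i; rewrite !mxE; ring.
Qed.

Lemma soliton_second_derivative0 p : ip g p (D xi grad p) (xi p) = 0.
Proof.
have cD := lc_connection lcD.
have [V [sV V1 Vxi R0 _]] := soliton_pointwise p.
pose H := inner g (D xi grad) xi.
have sH : smooth_fun H := smooth_inner g (smooth_conn lcD sxi sgrad) sxi.
have sphi : smooth_fun phi := smooth_inner g sgrad sxi.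
pose b q := (1 - lambda) + (-1) * phi q.
have sb : smooth_fun b.
  apply: smooth_fun_add; first exact: smooth_fun_cst.
  by apply: smooth_fun_mul => //; exact: smooth_fun_cst.
pose s q := H q + (-1) * b q.
have ss : smooth_fun s.
  by apply: smooth_fun_add => //; apply: smooth_fun_mul => //; exact: smooth_fun_cst.
have spsi U : smooth_vf U -> smooth_fun (inner g U xi) by move=> sU; exact: smooth_inner.
have spsi' U : smooth_vf U -> smooth_fun (fun q => s q * inner g U xi q).
  by move=> sU; apply: smooth_fun_mul => //; exact: spsi.
(* The pointwise formulas at all [q] form an identity of smooth fields, which can be differentiated;
   [V] is adapted to the single point [p] only. *)
have DE U : smooth_vf U ->
    D U grad = vf_add (vf_scale b U) (vf_scale (fun q => s q * inner g U xi q) xi).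
  move=> sU; apply/funext => q; have [_ [_ _ _ _ [_ ->//]]] := soliton_pointwise q.
  rewrite /vf_add /vf_scale /s /b /H !innerE; congr (_ *: _ + (_ * _) *: _); ring.
have DDE W U : smooth_vf W -> smooth_vf U -> D W (D U grad) p =
    vf_app W b p *: U p + b p *: D W U p +
    vf_app W (fun q => s q * inner g U xi q) p *: xi p.
  move=> sW sU; rewrite DE// (conn_addr cD); [|done|exact: smooth_vf_scale|].
    rewrite (conn_leibniz cD sb sW sU) (conn_leibniz cD (spsi' _ sU) sW sxi).
    by rewrite (xi_par sW) /vf_add /vf_scale scaler0 addr0.
  by apply: smooth_vf_scale => //; exact: spsi'.
have xib : vf_app xi b p = - ip g p (D xi grad p) (xi p).
  rewrite vf_app_add; [|exact: smooth_fun_cst|]; last first.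
    by apply: smooth_fun_mul => //; exact: smooth_fun_cst.
  rewrite vf_app_mul//; last exact: smooth_fun_cst.
  by rewrite !vf_app_cst (vf_app_psi lcD sxi xi_par sxi sgrad) !innerE; ring.
have sB := smooth_bracket lcD sxi sV.
have := curvature_inner_skew lcD p sxi sV sgrad sV.
(* Paired with [V] at [p], all multiples of [xi] vanish, and the two terms [b g(D_xi V, V)] cancel
   because [[xi, V] = D_xi V]. Only [xi(b) = - H] is left, and it equals 0. *)
rewrite R0 ip0l oppr0 curvature_unfold !DDE// DE// /vf_add /vf_scale.
rewrite (bracketE lcD)// (xi_par sV) subr0 xib.
rewrite !(ipNl, ipDl, ipZl) V1 ip0l ![ip g p (xi p) _]ipC Vxi !mulr0.
by move=> E; apply/eqP; rewrite -oppr_eq0 -E; apply/eqP; ring.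
Qed.

Lemma soliton_scal p : scal p = 2 * (2 + lambda + phi p).
Proof.
have [_ [_ _ _ _ [-> _]]] := soliton_pointwise p.
by rewrite soliton_second_derivative0 addr0.
Qed.

(** The derivative is [g(D_U grad f, xi) = b psi(U) + (H - b) psi(U) = H psi(U)], and [H = 0]. *)
Lemma soliton_phi_stationary U p : smooth_vf U -> vf_app U phi p = 0.
Proof.
move=> sU; rewrite (vf_app_psi lcD sxi xi_par sU sgrad) innerE.
have [_ [_ _ _ _ [_ ->//]]] := soliton_pointwise p.
rewrite soliton_second_derivative0 ipDl !ipZl.
have := xi_unit p; rewrite innerE => ->; ring.
Qed.

End Soliton.

Theorem theorem6p1 (R : realType) (N : smooth_manifold R 3)
    (N_connected : connected [set: N])
    (g : riemannian_metric N)
    (nabla : vfield N -> vfield N -> vfield N)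
    (nabla_lc : is_levi_civita g nabla)
    (xi : vfield N)
    (xi_smooth : smooth_vf xi)
    (xi_unit : forall p : N, inner g xi xi p = 1)
    (xi_parallel : forall U : vfield N, smooth_vf U ->
       forall p : N, nabla U xi p = 0)
    (soliton : gradient_einstein_soliton g (semi_symmetric_conn g nabla xi)) :
  constant_scalar_curvature g (semi_symmetric_conn g nabla xi) \/
  constant_sectional_curvature g (semi_symmetric_conn g nabla xi).
Proof.
left.
have xi_par U : smooth_vf U -> nabla U xi = fun=> 0.
  by move=> sU; apply/funext => p; exact: xi_parallel.
have [f [lambda [sf sol]]] := soliton.
have sphi : smooth_fun (inner g (gradient g f) xi).
  by apply: metric_smooth => //; exact: smooth_gradient.
have [c phic] := vf_app0_constant N_connected sphi
  (fun U sU p => soliton_phi_stationary nabla_lc xi_smooth xi_unit xi_par sf sol p sU).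
(* The constant is the formula of [soliton_scal] with [phi] replaced by its constant value [c]. *)
exists (2 * (2 + lambda + c)) => p.
by rewrite (soliton_scal nabla_lc xi_smooth xi_unit xi_par sf sol) phic.
Qed.
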